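(* For each positive integer $m$ there exist rational functions $W_m=W_m(a,b,c,d,e,f)$ and $\mu_m=\mu_m(a,b,c,d,e,f)$ such that $$ {}_4F_3\!\left(\begin{array}{c} a,b,c,f+m\\ d,e,f\end{array}\right)=W_m(a,b,c,d,e,f)\,{}_4F_3\!\left(\begin{array}{c} a,b,c,\mu_m+1\\ d,e,\mu_m\end{array}\right). $$ Writing $s=d+e-a-b-c-1$, the functions $W_m$ and $\mu_m$ are computed recursively (for $m\ge 2$) by $$ W_{m+1}=W_m+\frac{abc\,\nu_m}{(s-1)f\sigma_m}, \qquad \mu_{m+1}=W_{m+1}\left(\frac{W_m}{\mu_m}+\frac{abc\,\nu_m}{(s-1)f\sigma_m\eta_m}\right)^{-1}, $$ where $$ \nu_m=W_m(a+1,b+1,c+1,d+1,e+1,f+1),\qquad \sigma_m=\mu_m(a+1,b+1,c+1,d+1,e+1,f+1), $$ $$ \eta_m=\frac{abc}{ab+ac+bc-de+d+e+(s-1)(\sigma_m-1)-1}, $$ and the initial values are $$ W_2=1+\frac{abc}{(s-1)f(f+1)},\qquad \mu_2=\frac{abc+(s-1)f(f+1)}{ab+ac+bc-de+d+e+(s-1)(2f+1)-1}. $$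
   Context: Notation: $(x)_0=1$, $(x)_n=x(x+1)\cdots(x+n-1)$ is the rising factorial, and the hypergeometric function is evaluated at unit argument, which is omitted from the notation: $$ {}_4F_3\!\left(\begin{array}{c} a_1,a_2,a_3,a_4\\ b_1,b_2,b_3\end{array}\right)=\sum_{n=0}^\infty \frac{(a_1)_n(a_2)_n(a_3)_n(a_4)_n}{(b_1)_n(b_2)_n(b_3)_n\,n!} $$ (no lower parameter is a non-positive integer). The parameters $a,b,c,d,e,f$ are complex. When $W_m$ or $\mu_m$ is evaluated at shifted arguments, the quantity $s$ in it is shifted accordingly, being a function of $a,b,c,d,e$. Standing convention: the parameters are assumed to be chosen so that all infinite series in the statement converge and the rational and gamma functions appearing in the formulas do not become infinite (all denominators are nonzero). *)

(* Defs.v *)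
From mathcomp Require Import all_boot all_order all_algebra.
From mathcomp Require Import all_classical all_reals all_analysis.
From mathcomp Require Import complex.
(* The notations of mpoly clash with those of MathComp-Analysis, so only its
   structure instances and coercions are imported. *)
From mathcomp Require Import (canonicals, coercions) mpoly.
Import Order.TTheory GRing.Theory Num.Theory numFieldNormedType.Exports.
Set Implicit Arguments.
Unset Strict Implicit.
Unset Printing Implicit Defensive.
Local Open Scope ring_scope.
Local Open Scope classical_set_scope.

Definition rising (K : nzRingType) (x : K) (n : nat) : K :=
  \prod_(k < n) (x + k%:R).

Definition nonpos_int (K : nzRingType) (x : K) : Prop :=
  exists n : nat, x = - n%:R.

(* The series are taken in R[i]^o, which carries the topology of the complex
   norm. *)
Definition hyp4F3_term (R : realType) (a1 a2 a3 a4 b1 b2 b3 : R[i]) :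
    nat -> R[i]^o := fun n =>
  (rising a1 n * rising a2 n * rising a3 n * rising a4 n) /
  (rising b1 n * rising b2 n * rising b3 n * n`!%:R).

Definition hyp4F3_cvg (R : realType) (a1 a2 a3 a4 b1 b2 b3 : R[i]) : Prop :=
  cvgn (series (hyp4F3_term a1 a2 a3 a4 b1 b2 b3)).

Definition hyp4F3 (R : realType) (a1 a2 a3 a4 b1 b2 b3 : R[i]) : R[i] :=
  limn (series (hyp4F3_term a1 a2 a3 a4 b1 b2 b3)).

(* Polynomials and rational functions in six variables, standing for
   a, b, c, d, e, f in this order. *)
Definition poly6 (R : realType) := mpoly.mpoly 6 R[i].
Definition ratfun6 (R : realType) : fieldType := {fraction (poly6 R)}.

Definition pvar (R : realType) (i : 'I_6) : poly6 R :=
  mpoly.mpolyX R[i] (mpoly.mnm1 i).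

Definition rfvar (R : realType) (i : 'I_6) : ratfun6 R := FracField.tofrac (pvar R i).

Definition pshift (R : realType) (p : poly6 R) : poly6 R :=
  mpoly.comp_mpoly [tuple pvar R i + 1 | i < 6] p.

(* The rational function x(a+1, b+1, c+1, d+1, e+1, f+1). Since pshift is an
   injective ring morphism, the result does not depend on the fraction chosen
   to represent x. *)
Definition rfshift (R : realType) (x : ratfun6 R) : ratfun6 R :=
  FracField.tofrac (pshift (fraction.frac (repr x)).1) /
  FracField.tofrac (pshift (fraction.frac (repr x)).2).

Definition point6 (R : realType) (a b c d e f : R[i]) : 'I_6 -> R[i] :=
  tnth [tuple a; b; c; d; e; f].

(* x is finite at v and takes there the value y: x can be written as a
   fraction whose denominator does not vanish at v. *)
Definition rfvalue (R : realType) (x : ratfun6 R) (v : 'I_6 -> R[i])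
    (y : R[i]) : Prop :=
  exists p q : poly6 R,
    [/\ x = FracField.tofrac p / FracField.tofrac q, mpoly.meval v q != 0 &
        y = mpoly.meval v p / mpoly.meval v q].

(* Main.v *)
Require Import Defs.
From HB Require Import structures.
From mathcomp Require Import all_boot all_order all_algebra.
From mathcomp Require Import all_classical all_reals all_analysis.
From mathcomp Require Import complex.
From mathcomp Require Import ring lra.
From mathcomp Require Import (canonicals, coercions) mpoly.
Import Order.TTheory GRing.Theory Num.Theory numFieldNormedType.Exports.
Set Implicit Arguments.
Unset Strict Implicit.
Unset Printing Implicit Defensive.
Local Open Scope ring_scope.

(** Put T_k = (a)_k (b)_k (c)_k / ((d)_k (e)_k k!).  Since
    (f+m)_k / (f)_k = (f+k)_m / (f)_m, the left-hand series is the sum of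
    T_k q(k) with q(x) = (f+x)_m / (f)_m, a polynomial of degree m, while
    W times the right-hand series is the sum of T_k (W + (W / mu) k).  The
    theorem thus says that a weight of degree m can be traded for a weight of
    degree 1.

    The trade is by telescoping: as
      T_(k+1) (k+1) (d+k) (e+k) = T_k (a+k) (b+k) (c+k),
    for every polynomial P the weight
      (a+k) (b+k) (c+k) P(k) - k (d+k-1) (e+k-1) P(k-1)
    sums to a single boundary term.  For P = 1 this weight is
      - (s-1) k^2 + (ab+ac+bc-de+d+e-1) k + abc,
    so it removes a quadratic term as long as s <> 1.  From
      (f+x)_(m+1) / (f)_(m+1)
        = (f+x)_m / (f)_m + (x/f) ((f+1)+(x-1))_m / (f+1)_m,
    whose last quotient is the preceding one with all parameters raised by 1
    and x lowered by 1, one gets by recursion the constants A, B (reduction)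
    and the polynomial P (certificate) such that q(x) = A + B x + the weight
    of P (rising_quotient_reduction).  Hence W_m = A and mu_m = A / B, and the
    recursion of the theorem is the recursion of the pair (A, B)
    (gen_reduction_rec).

    Two points are delicate when the identity is evaluated at complex
    numbers (hyp4F3_reduction).

    - The recursion divides by s-1, ..., s-m+1 and the boundary term has to
      vanish in the limit, although the series is only known to converge,
      perhaps conditionally.  Let t_k be its terms and g_k = k t_k.  Then
      g_(k+1) = (1 + beta/k + O(1/k^2)) g_k with beta = m - 1 - s.  As
      the series converges, so does g_k, and its limit must be 0, since
      otherwise the sum of t_k = g_k / k diverges like the harmonic series
      (slowly_varying_cvg0); the boundary term is O(g_k) (boundary_le).  If s were one of
      1, ..., m-1, then beta would be a natural number and g_k could not tend
      to 0 without vanishing (slowly_varying_eq0), so s is not one of them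
      unless the series terminates.

    - If a, b or c is a nonpositive integer, s may be one of 1, ..., m-1 at a
      point where W_m and mu_m happen to be regular.  Both sides are then
      finite sums, continuous in e, and the identity extends from e + t to e
      as t tends to 0 (terminating_sum_eq0).

    That A, B and the denominator of eta are not the zero rational function
    is seen by evaluating them where a, b, c, f > 0, e >= 0, d <= -n, s > n: all
    terms of the recursion are nonnegative there (reduction_gt0). *)

(** * Reduction of a polynomial weight to a linear one *)

Section Reduction.
Variable F : fieldType.
Implicit Types a b c d e f x : F.

Definition excess a b c d e := d + e - a - b - c - 1.

(** The coefficient of x in
    (a+x) (b+x) (c+x) - x (d+x-1) (e+x-1). *)
Definition slope a b c d e := a * b + a * c + b * c - d * e + d + e - 1.

(** The constants (A, B) for m = n+1.  The index is shifted because the case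
    m = 1, unlike a case m = 0 followed by one recursion step, involves no
    division by s-1. *)
Fixpoint reduction (n : nat) a b c d e f : F * F :=
  if n is n'.+1 then
    let s1 := excess a b c d e - 1 in
    let r := reduction n' a b c d e f in
    let r' := reduction n' (a + 1) (b + 1) (c + 1) (d + 1) (e + 1) (f + 1) in
    (r.1 + a * b * c / (s1 * f) * r'.2,
     r.2 + (r'.1 + (slope a b c d e / s1 - 1) * r'.2) / f)
  else (1, f^-1).

(** The polynomial P of the telescoping weight for m = n+1, as a function
    of x.  It satisfies the recursion of reduction, where the last summand
    cancels the quadratic term x (x-1) B'/f. *)
Fixpoint certificate (n : nat) a b c d e f x : F :=
  if n is n'.+1 then
    let r' := reduction n' (a + 1) (b + 1) (c + 1) (d + 1) (e + 1) (f + 1) in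
    certificate n' a b c d e f x
    + x * certificate n' (a + 1) (b + 1) (c + 1) (d + 1) (e + 1) (f + 1) (x - 1) / f
    - r'.2 / ((excess a b c d e - 1) * f)
  else 0.

Lemma risingS x n : rising x n.+1 = rising x n * (x + n%:R).
Proof. by rewrite /rising big_ord_recr. Qed.

Lemma rising_shift x n : rising x n.+1 = x * rising (x + 1) n.
Proof.
rewrite /rising big_ord_recl addr0; congr (_ * _).
by apply: eq_bigr => i _; rewrite -addrA -natr1 [1 + _]addrC.
Qed.

Lemma rising_neq0 x n : (forall i, (i < n)%N -> x + i%:R != 0) -> rising x n != 0.
Proof. by move=> h; apply/prodf_neq0 => i _; apply: h. Qed.

Lemma excess_shift a b c d e :
  excess (a + 1) (b + 1) (c + 1) (d + 1) (e + 1) = excess a b c d e - 1.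
Proof. by rewrite /excess; ring. Qed.

Lemma shiftD x n : x + 1 + n%:R = x + n.+1%:R.
Proof. by rewrite -natr1; ring. Qed.

(** Induction on n through
    (f+x)_(m+1) / (f)_(m+1) = (f+x)_m / (f)_m + (x/f) (f+x)_m / (f+1)_m:
    both quotients are reduced by the induction hypothesis, the second one at
    the shifted parameters and at x-1.  Multiplication by x turns a shifted
    telescoping weight into the weight of x P'(x-1), and the quadratic term
    left over is removed by a constant certificate. *)
Lemma rising_quotient_reduction n a b c d e f x :
    (forall i, (i <= n)%N -> f + i%:R != 0) ->
    (forall i, (i < n)%N -> excess a b c d e - i.+1%:R != 0) ->
  let P := certificate n a b c d e f in
  rising (f + x) n.+1 / rising f n.+1
    = (reduction n a b c d e f).1 + (reduction n a b c d e f).2 * x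
      + ((a + x) * (b + x) * (c + x) * P x
         - x * (d + x - 1) * (e + x - 1) * P (x - 1)).
Proof.
elim: n a b c d e f x => [|n IH] a b c d e f x f0 s0 /=.
  rewrite !risingS /rising !big_ord0 !addr0 !mul1r !mulr0 subr0 addr0.
  by have := f0 0%N isT; rewrite addr0 => h; field.
have f0' : f != 0 by have := f0 0%N isT; rewrite addr0.
have s1 : excess a b c d e - 1 != 0 by apply: (s0 0%N).
have IH0 := IH a b c d e f x (fun i h => f0 i (leqW h)) (fun i h => s0 i (leqW h)).
have f1 i : (i <= n)%N -> f + 1 + i%:R != 0 by move=> hi; rewrite shiftD; apply: f0.
have s2 i : (i < n)%N ->
    excess (a + 1) (b + 1) (c + 1) (d + 1) (e + 1) - i.+1%:R != 0.
  by move=> hi; rewrite excess_shift -addrA -opprD nat1r; apply: s0.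
have := IH (a + 1) (b + 1) (c + 1) (d + 1) (e + 1) (f + 1) (x - 1) f1 s2.
rewrite (_ : f + 1 + (x - 1) = f + x); last by ring.
move=> IH1.
have rec : rising (f + x) n.+2 / rising f n.+2 =
    rising (f + x) n.+1 / rising f n.+1
    + x / f * (rising (f + x) n.+1 / rising (f + 1) n.+1).
  have R0 : rising f n.+1 != 0 by apply: rising_neq0 => i hi; apply: f0; apply: ltnW.
  have fn := f0 n.+1 (leqnn _).
  have R1 : rising (f + 1) n.+1 = rising f n.+1 * (f + n.+1%:R) / f.
    by apply: (mulfI f0'); rewrite -rising_shift risingS mulrCA divff // mulr1.
  rewrite risingS [rising f n.+2]risingS R1.
  field; rewrite R0 f0' andbT /=.
  by rewrite nat1r.
rewrite rec IH0 IH1.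
set r' := reduction n (a + 1) _ _ _ _ _.
set r := reduction n a _ _ _ _ _.
set p := certificate n a _ _ _ _ _.
set p' := certificate n (a + 1) _ _ _ _ _.
rewrite /slope /excess in s1 *.
field.
by rewrite f0' s1.
Qed.

End Reduction.

Lemma reduction_morph (F1 F2 : fieldType) (h : {rmorphism F1 -> F2}) n a b c d e f :
  reduction n (h a) (h b) (h c) (h d) (h e) (h f)
    = (h (reduction n a b c d e f).1, h (reduction n a b c d e f).2).
Proof.
elim: n a b c d e f => [|n IH] a b c d e f /=; first by rewrite rmorph1 fmorphV.
have h1 z : h z + 1 = h (z + 1) by rewrite rmorphD rmorph1.
rewrite !h1 !IH /= /excess /slope.
by rewrite !(rmorphD, rmorphN, rmorphM, fmorphV, rmorph1).
Qed.

(** The difference is ab + ac + bc + a + b + c + 1 - de. *)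
Lemma slope_ge_excess (K : numFieldType) (a b c d e : K) :
    0 < a -> 0 < b -> 0 < c -> d <= 0 -> 0 <= e ->
  0 <= slope a b c d e - (excess a b c d e - 1).
Proof.
move=> a0 b0 c0 d0 e0.
have -> : slope a b c d e - (excess a b c d e - 1) =
    a * b + a * c + b * c + a + b + c + 1 + (- d) * e.
  by rewrite /slope /excess; ring.
by rewrite !addr_ge0 ?mulr_ge0 ?oppr_ge0 // ltW.
Qed.

(** The recursion raises d and lowers s by 1 at each step; the bounds on d and
    s keep d <= 0 and s > 1 through all n steps, so that every summand of the
    recursion is nonnegative. *)
Lemma reduction_gt0 (K : numFieldType) n (a b c d e f : K) :
    0 < a -> 0 < b -> 0 < c -> 0 < f -> 0 <= e ->
    d + n%:R <= 0 -> n%:R < excess a b c d e ->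
  0 < (reduction n a b c d e f).1 /\ 0 < (reduction n a b c d e f).2.
Proof.
elim: n a b c d e f => [|n IH] a b c d e f a0 b0 c0 f0 e0 dn sn /=.
  by rewrite invr_gt0.
have dn' : d + 1 + n%:R <= 0 by rewrite shiftD.
have sn' : n%:R < excess (a + 1) (b + 1) (c + 1) (d + 1) (e + 1).
  by rewrite excess_shift ltrBrDr natr1.
have [A0 B0] : 0 < (reduction n a b c d e f).1 /\ 0 < (reduction n a b c d e f).2.
  apply: IH => //; first by apply: le_trans dn; rewrite lerD2l ler_nat.
  by apply: le_lt_trans sn; rewrite ler_nat.
have [A1 B1] := IH (a + 1) (b + 1) (c + 1) (d + 1) (e + 1) (f + 1)
  (addr_gt0 a0 ltr01) (addr_gt0 b0 ltr01) (addr_gt0 c0 ltr01)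
  (addr_gt0 f0 ltr01) (addr_ge0 e0 ler01) dn' sn'.
have s1 : 0 < excess a b c d e - 1.
  by rewrite subr_gt0; apply: le_lt_trans sn; rewrite ler1n.
split; first by rewrite addr_gt0 // mulr_gt0 // divr_gt0 ?mulr_gt0.
rewrite addr_gt0 // divr_gt0 // ltr_wpDr // mulr_ge0 //; last exact: ltW.
have -> : slope a b c d e / (excess a b c d e - 1) - 1 =
    (slope a b c d e - (excess a b c d e - 1)) / (excess a b c d e - 1).
  by rewrite [RHS]mulrBl divff // lt0r_neq0.
rewrite divr_ge0 ?(ltW s1) //.
apply: slope_ge_excess => //; by apply: le_trans dn; rewrite lerDl ler0n.
Qed.

Section Terms.
Variable K : numFieldType.
Implicit Types a b c d e f x : K.

Definition term a b c d e (n : nat) : K :=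
  rising a n * rising b n * rising c n / (rising d n * rising e n * n`!%:R).

Lemma risingD x m n : rising x (m + n) = rising x m * rising (x + m%:R) n.
Proof.
rewrite /rising big_split_ord /=; congr (_ * _).
by apply: eq_bigr => i _; rewrite natrD addrA.
Qed.

Lemma termS a b c d e n : d + n%:R != 0 -> e + n%:R != 0 ->
  term a b c d e n.+1 * (n.+1%:R * (d + n%:R) * (e + n%:R))
    = term a b c d e n * ((a + n%:R) * (b + n%:R) * (c + n%:R)).
Proof.
move=> d0 e0; rewrite /term !risingS factS natrM.
have n0 : n.+1%:R != 0 :> K by rewrite pnatr_eq0.
rewrite !invfM; set D := (rising d n)^-1; set E := (rising e n)^-1.
set N := (n`!%:R)^-1; move: n.+1%:R n0 => M n0.
by field; rewrite n0 d0 e0.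
Qed.

(** The telescoping sum at finite N: the weight of the certificate leaves the
    boundary term only, because the lower boundary term has the factor 0. *)
Lemma sum_term_reduce n a b c d e f N :
    (forall k, (k < N)%N -> d + k%:R != 0) ->
    (forall k, (k < N)%N -> e + k%:R != 0) ->
    (forall i, (i <= n)%N -> f + i%:R != 0) ->
    (forall i, (i < n)%N -> excess a b c d e - i.+1%:R != 0) ->
  \sum_(k < N) term a b c d e k * (rising (f + k%:R) n.+1 / rising f n.+1)
    = \sum_(k < N) term a b c d e k
        * ((reduction n a b c d e f).1 + (reduction n a b c d e f).2 * k%:R)
      + term a b c d e N * (N%:R * (d + N%:R - 1) * (e + N%:R - 1))
        * certificate n a b c d e f (N%:R - 1).
Proof.
move=> d0 e0 f0 s0; elim: N d0 e0 => [|N IH] d0 e0.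
  by rewrite !big_ord0 !mul0r mulr0 mul0r addr0.
rewrite !big_ord_recr /= IH; last 2 first.
- by move=> k kN; apply: d0; apply: leqW.
- by move=> k kN; apply: e0; apply: leqW.
have N1 (z : K) : z + N.+1%:R - 1 = z + N%:R by rewrite -natr1; ring.
have -> : N.+1%:R - 1 = N%:R :> K by rewrite -natr1 addrK.
rewrite !N1 (termS _ _ _ (d0 N (leqnn _)) (e0 N (leqnn _))).
rewrite (rising_quotient_reduction _ f0 s0) /=.
ring.
Qed.

End Terms.

(** (f+m)_k / (f)_k = (f+k)_m / (f)_m, both being the quotient of (f)_(k+m)
    by (f)_k (f)_m. *)
Lemma hyp4F3_termE (R : realType) (a b c d e f : R[i]) m k :
    (forall i, f + i%:R != 0) ->
  hyp4F3_term a b c (f + m%:R) d e f k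
    = term a b c d e k * (rising (f + k%:R) m / rising f m).
Proof.
move=> f0; have fn n : rising f n != 0 by apply: rising_neq0.
have : rising f k * rising (f + k%:R) m = rising f m * rising (f + m%:R) k.
  by rewrite -!risingD addnC.
move=> E; rewrite /hyp4F3_term /term.
have -> : rising (f + k%:R) m / rising f m = rising (f + m%:R) k / rising f k.
  apply/eqP; rewrite eqr_div //; apply/eqP.
  by rewrite mulrC E mulrC.
by rewrite !invfM; ring.
Qed.

(** * The recursion in terms of W, mu, sigma and eta *)

Section RecursionShape.
Variables (F : fieldType) (a b c d e f : F).
Local Notation s := (excess a b c d e).

Lemma reduction1_fst : (reduction 1 a b c d e f).1 = 1 + a * b * c / ((s - 1) * f * (f + 1)).
Proof. by congr (_ + _); rewrite [in RHS]invfM mulrA. Qed.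

Lemma reduction1_ratio : f != 0 -> f + 1 != 0 -> s - 1 != 0 ->
  (reduction 1 a b c d e f).1 / (reduction 1 a b c d e f).2
    = (a * b * c + (s - 1) * f * (f + 1))
      / (a * b + a * c + b * c - d * e + d + e + (s - 1) * (2 * f + 1) - 1).
Proof.
move=> f0 f1 s1; rewrite reduction1_fst /=.
set D := (X in _ = _ / X).
have -> : f^-1 + (1 + (slope a b c d e / (s - 1) - 1) / (f + 1)) / f
    = D / ((s - 1) * f * (f + 1)).
  rewrite /D /slope; move: (s - 1) s1 => s1 s10; field.
  by rewrite f0 f1 s10.
have -> : 1 + a * b * c / ((s - 1) * f * (f + 1))
    = (a * b * c + (s - 1) * f * (f + 1)) / ((s - 1) * f * (f + 1)).
  by move: (s - 1) s1 => s1 s10; field; rewrite f0 f1 s10.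
by rewrite invf_div mulrA divfK // !mulf_neq0.
Qed.

Variable n : nat.
Let A := (reduction n a b c d e f).1.
Let B := (reduction n a b c d e f).2.
Let nu := (reduction n (a + 1) (b + 1) (c + 1) (d + 1) (e + 1) (f + 1)).1.
Let B' := (reduction n (a + 1) (b + 1) (c + 1) (d + 1) (e + 1) (f + 1)).2.
Let sigma := nu / B'.
Let eta := a * b * c
  / (a * b + a * c + b * c - d * e + d + e + (s - 1) * (sigma - 1) - 1).

Lemma reductionS_fst : nu != 0 ->
  (reduction n.+1 a b c d e f).1 = A + a * b * c * nu / ((s - 1) * f * sigma).
Proof.
move=> nu0; rewrite /= -/A -/B' /sigma; congr (_ + _).
rewrite [in RHS]invfM invf_div; move: ((s - 1) * f)^-1 => q.
by field.
Qed.

Lemma reductionS_snd : a * b * c != 0 -> s - 1 != 0 -> f != 0 -> nu != 0 -> B' != 0 ->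
    A != 0 ->
  (reduction n.+1 a b c d e f).2
    = A / (A / B) + a * b * c * nu / ((s - 1) * f * sigma * eta).
Proof.
move=> abc0 s1 f0 nu0 B'0 A0.
rewrite /= -/B -/B' -/nu invf_div mulrCA divff // mulr1; congr (_ + _).
rewrite /eta /sigma /slope.
rewrite [in RHS]invfM invf_div.
move: (a * b * c) abc0 (s - 1) s1 => p p0 s1 s10.
by field; rewrite p0 s10 f0 nu0 B'0.
Qed.

End RecursionShape.

(** * The modulus with values in the reals *)

(** The norm of R[i] takes its values in R[i], whose order is only partial; a
    real-valued modulus makes linear arithmetic available. *)
Notation cabs := Normc.normc.

Section Modulus.
Variable R : realType.
Implicit Types x y z : R[i].

Lemma cabs_ge0 z : 0 <= cabs z.
Proof. by case: z => x y; apply: sqrtr_ge0. Qed.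

Lemma cabsN z : cabs (- z) = cabs z.
Proof. exact: normcN. Qed.

Lemma cabsD x y : cabs (x + y) <= cabs x + cabs y.
Proof. exact: le_normcD. Qed.

Lemma cabsB x y : cabs (x - y) <= cabs x + cabs y.
Proof. by rewrite -(cabsN y) cabsD. Qed.

Lemma cabs_distC x y : cabs (x - y) = cabs (y - x).
Proof. by rewrite -cabsN opprB. Qed.

Lemma cabsB_ge x y : cabs x - cabs y <= cabs (x - y).
Proof. by rewrite lerBlDr -{1}[x](subrK y) cabsD. Qed.

Lemma cabsM x y : cabs (x * y) = cabs x * cabs y.
Proof. exact: Normc.normcM. Qed.

Lemma cabsV x : cabs x^-1 = (cabs x)^-1.
Proof. exact: Normc.normcV. Qed.

Lemma cabs0 : cabs (0 : R[i]) = 0.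
Proof. exact: Normc.normc0. Qed.

Lemma cabs_eq0 z : (cabs z == 0) = (z == 0).
Proof. by apply/eqP/eqP => [/Normc.eq0_normc //|->]; rewrite cabs0. Qed.

Lemma cabs_gt0 z : (0 < cabs z) = (z != 0).
Proof. by rewrite lt_def cabs_ge0 andbT cabs_eq0. Qed.

Lemma cabs_real (r : R) : 0 <= r -> cabs (r%:C)%C = r.
Proof. by move=> r0; rewrite /= expr0n addr0 sqrtr_sqr ger0_norm. Qed.

Lemma cabs_nat n : cabs (n%:R : R[i]) = n%:R.
Proof. by rewrite -(rmorph_nat (@real_complex R)) cabs_real. Qed.

Lemma cabs_sum (I : Type) (r : seq I) (P : pred I) (F : I -> R[i]) :
  cabs (\sum_(i <- r | P i) F i) <= \sum_(i <- r | P i) cabs (F i).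
Proof.
elim/big_rec2: _ => [|i y x _ h]; first by rewrite cabs0.
by apply: le_trans (cabsD _ _) _; rewrite lerD2l.
Qed.

Lemma cvgn_cabsP (u : nat -> R[i]^o) (l : R[i]^o) :
  (u @ \oo --> l)%classic <->
  forall eps : R, 0 < eps -> exists n0, forall n, (n0 <= n)%N -> cabs (u n - l) <= eps.
Proof.
split=> [/cvgrPdist_le h eps eps0|h].
  have /h[n0 _ hn] : 0 < eps%:C%C :> R[i] by rewrite ltcR.
  by exists n0 => n /hn /=; rewrite cabs_distC -lecR.
apply/cvgrPdist_le => eps eps0.
have epsE : eps = (complex.Re eps)%:C%C by rewrite RRe_real // gtr0_real.
have /h[n0 hn] : 0 < complex.Re eps by rewrite -ltcR -epsE.
by exists n0 => // n /hn /=; rewrite epsE cabs_distC -lecR.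
Qed.

Lemma cvgn_cauchy (u : nat -> R[i]^o) : cvgn u ->
  forall eps : R, 0 < eps -> exists n0, forall p q, (n0 <= p)%N -> (n0 <= q)%N ->
    cabs (u p - u q) <= eps.
Proof.
move=> /cvg_ex[l /cvgn_cabsP h] eps eps0.
have /h[n0 hn] : 0 < eps / 2 by rewrite divr_gt0.
exists n0 => p q hp hq.
have -> : u p - u q = (u p - l) + (l - u q) by rewrite addrA subrK.
rewrite (splitr eps); apply: le_trans (cabsD _ _) _.
by apply: lerD; [exact: hn | rewrite cabs_distC; exact: hn].
Qed.

End Modulus.

(** * Sequences with ratio 1 + O(1/n^2) *)

Section RealEstimates.
Variable R : realType.

Lemma inv_mulSE (n : nat) : (0 < n)%N ->
  (n%:R * n.+1%:R)^-1 = n%:R^-1 - n.+1%:R^-1 :> R.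
Proof.
move=> n0; have n1 : n%:R != 0 :> R by rewrite pnatr_eq0 -lt0n.
have n2 : n%:R + 1 != 0 :> R by rewrite natr1 pnatr_eq0.
by rewrite -natr1; move: n%:R n1 n2 => x x0 x1; field; rewrite x0 x1.
Qed.

(** A product of factors 1 + x_k is at most 2 when the sum of the x_k is at
    most 1/2; here x_k = C/(k(k+1)), whose sum from K telescopes to at most
    C/K. *)
Lemma product_le2 (C : R) (K : nat) (y : nat -> R) :
    (0 < K)%N -> 0 <= C -> C / K%:R <= 2^-1 -> (forall n, 0 <= y n) ->
    (forall n, (K <= n)%N -> y n.+1 <= (1 + C / (n%:R * n.+1%:R)) * y n) ->
  forall n, (K <= n)%N -> y n <= 2 * y K.
Proof.
move=> K0 C0 CK y0 hy n Kn.
have inv0 (p : nat) : 0 <= C / p%:R by rewrite divr_ge0.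
(* y n times 1 - (x_K + ... + x_(n-1)) stays below y K, as
   (1 + x) (1 - z - x) <= 1 - z *)
suff h : y n * (1 - (C / K%:R - C / n%:R)) <= y K.
  by have := inv0 n; have := y0 n; nra.
elim: n Kn => [|n IH]; first by rewrite leqn0 => /eqP K0'; rewrite K0' in K0.
rewrite leq_eqVlt => /orP[/eqP <-|]; first by rewrite subrr subr0 mulr1.
rewrite ltnS => Kn; have n0 : (0 < n)%N by apply: leq_trans Kn.
apply: le_trans (IH Kn).
have := hy n Kn; rewrite inv_mulSE // mulrBr.
have := inv0 n; have := inv0 n.+1; have := y0 n; have := y0 n.+1.
have : C / n.+1%:R <= C / n%:R by rewrite ler_wpM2l // lef_pV2 ?posrE ?ltr0n // ler_nat.
have : C / n%:R <= C / K%:R by rewrite ler_wpM2l // lef_pV2 ?posrE ?ltr0n // ler_nat.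
move: (C / n%:R) (C / n.+1%:R) (C / K%:R) CK (y n) (y n.+1) => p q r r2 z z' pr qp z'0 z0 q0 p0 h.
apply: le_trans (_ : (1 + (p - q)) * z * (1 - (r - q)) <= _).
  by rewrite ler_wpM2r //; lra.
have : 0 <= z * ((p - q) * (r - q)) by rewrite !mulr_ge0 //; lra.
by lra.
Qed.

Lemma product_ge2 (C : R) (K : nat) (y : nat -> R) :
    (0 < K)%N -> 0 <= C -> C / K%:R <= 2^-1 -> (forall n, 0 <= y n) ->
    (forall n, (K <= n)%N -> (1 - C / (n%:R * n.+1%:R)) * y n <= y n.+1) ->
  forall n, (K <= n)%N -> y K <= 2 * y n.
Proof.
move=> K0 C0 CK y0 hy n Kn.
have inv0 (p : nat) : 0 <= C / p%:R by rewrite divr_ge0.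
(* (1 - x) (1 - z) >= 1 - z - x *)
suff h : y K * (1 - (C / K%:R - C / n%:R)) <= y n.
  by have := inv0 n; have := y0 K; nra.
elim: n Kn => [|n IH]; first by rewrite leqn0 => /eqP K0'; rewrite K0' in K0.
rewrite leq_eqVlt => /orP[/eqP <-|]; first by rewrite subrr subr0 mulr1.
rewrite ltnS => Kn; have n0 : (0 < n)%N by apply: leq_trans Kn.
have := IH Kn; have := hy n Kn; rewrite inv_mulSE // mulrBr.
have := inv0 n; have := inv0 n.+1; have := y0 n; have := y0 K.
have : C / n.+1%:R <= C / n%:R by rewrite ler_wpM2l // lef_pV2 ?posrE ?ltr0n // ler_nat.
have : C / n%:R <= C / K%:R by rewrite ler_wpM2l // lef_pV2 ?posrE ?ltr0n // ler_nat.
move: (C / n%:R) (C / n.+1%:R) (C / K%:R) CK (y n) (y n.+1) (y K) => p q r r2 z z' w pr qp w0 z0 q0 p0 h1 h2.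
apply: le_trans h1.
apply: le_trans (_ : (1 - (p - q)) * (w * (1 - (r - p))) <= _); last first.
  by rewrite ler_wpM2l //; lra.
have : 0 <= w * ((p - q) * (r - p)) by rewrite !mulr_ge0 //; lra.
by lra.
Qed.

Lemma harmonic_unbounded (n : nat) (M : R) : (0 < n)%N ->
  exists p, (n <= p)%N /\ M < \sum_(n <= k < p) k%:R^-1.
Proof.
case: n => // n _.
have mono : {homo series (@harmonic R) : p q / (p <= q)%N >-> p <= q}.
  apply/nondecreasing_seqP => k.
  by rewrite /series /= big_nat_recr //= lerDl invr_ge0 ler0n.
have /cvgryPgt/(_ (series (@harmonic R) n + M))[p _ hp] :=
  nondecreasing_dvgn_lt mono (@dvg_harmonic R).
exists (maxn n p).+1; split; first by rewrite ltnS leq_maxl.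
rewrite big_add1 /= -(ltrD2l (series (@harmonic R) n)).
rewrite {2}/series /= -big_cat_nat //= ?leq_maxl //.
exact: (hp (maxn n p) (leq_maxr n p)).
Qed.

End RealEstimates.

Section SlowlyVarying.
Variable R : realType.

Lemma exists_index_ge (C : R) (eps : R) (K0 : nat) : 0 <= C -> 0 < eps ->
  exists K, [/\ (0 < K)%N, (K0 <= K)%N & forall n, (K <= n)%N -> C / n%:R <= eps].
Proof.
move=> C0 eps0; exists (maxn K0 (Num.bound (C / eps)).+1); split.
- by rewrite leq_max orbT.
- exact: leq_maxl.
- move=> n; rewrite geq_max => /andP[_ hn].
  have n0 : 0 < n%:R :> R by rewrite ltr0n; apply: leq_trans hn.
  rewrite ler_pdivrMr // mulrC -ler_pdivrMr //.
  apply/ltW; apply: lt_le_trans (archi_boundP (divr_ge0 C0 (ltW eps0))) _.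
  by rewrite ler_nat ltnW.
Qed.

Variables (g : nat -> R[i]) (C : R) (K0 : nat).
Hypothesis C0 : 0 <= C.

(** Let S be the partial sums of t.  Up to beta S, the increments of g are
    O(1/n^2) times g, so g is bounded by a discrete Gronwall argument and then
    a Cauchy sequence, as S is one.  If g stayed away from 0 from some index n
    on, it would be close to the constant g n, and the increments of S would
    be comparable to g n times those of the harmonic series. *)
Lemma slowly_varying_cvg0 (t : nat -> R[i]^o) (beta : R[i]) :
    cvgn (series t) -> (forall n, g n = n%:R * t n) ->
    (forall n, (K0 <= n)%N -> cabs (g n.+1 - g n - beta * t n)
       <= C / (n%:R * n.+1%:R) * cabs (g n)) ->
  forall eps, 0 < eps -> exists n0, forall n, (n0 <= n)%N -> cabs (g n) <= eps.
Proof.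
move=> cvgt gE hg.
have [K [Kpos K0K CK]] := exists_index_ge K0 C0 (ltac:(by rewrite invr_gt0) : 0 < 2^-1 :> R).
set S := series t.
have Sdiff n p : (n <= p)%N -> S p - S n = \sum_(n <= k < p) t k.
  by move=> np; rewrite sub_series_geq.
have [B [B0 hB]] : exists B, 0 <= B /\ forall n, cabs (beta * (S n - S K)) <= B.
  have [n0 hn0] := cvgn_cauchy cvgt ltr01.
  pose b := \sum_(n < n0) cabs (beta * (S n - S K)) + cabs (beta * (S n0 - S K)) + cabs beta.
  have b0 n : 0 <= cabs (beta * (S n - S K)) by apply: cabs_ge0.
  exists b; split; first by rewrite !addr_ge0 ?sumr_ge0 ?cabs_ge0.
  move=> n; have [nn0|n0n] := ltnP n n0.
    rewrite /b (bigD1 (Ordinal nn0)) //= -!addrA lerDl.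
    by rewrite !addr_ge0 ?sumr_ge0 ?cabs_ge0.
  have -> : S n - S K = (S n - S n0) + (S n0 - S K) by rewrite addrA subrK.
  rewrite mulrDr; apply: le_trans (cabsD _ _) _.
  have h1 : cabs (beta * (S n - S n0)) <= cabs beta.
    by rewrite cabsM ler_piMr ?cabs_ge0 ?hn0.
  have h2 : 0 <= \sum_(n < n0) cabs (beta * (S n - S K)) by apply: sumr_ge0.
  by rewrite /b; lra.
(* k is the part of g that is not controlled by the partial sums *)
pose k n := g n - beta * (S n - S K).
have kS n : k n.+1 - k n = g n.+1 - g n - beta * t n.
  by rewrite /k /S seriesSr; ring.
have kg n : cabs (g n) <= cabs (k n) + B.
  by rewrite -[g n](subrK (beta * (S n - S K))); apply: le_trans (cabsD _ _) _; rewrite lerD2l.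
have kstep n : (K <= n)%N ->
    cabs (k n.+1 - k n) <= C / (n%:R * n.+1%:R) * (cabs (k n) + B).
  move=> Kn; rewrite kS; apply: le_trans (hg n (leq_trans K0K Kn)) _.
  by rewrite ler_wpM2l ?divr_ge0 ?mulr_ge0.
pose M := 2 * (cabs (k K) + B).
have kM n : (K <= n)%N -> cabs (k n) + B <= M.
  move: n; apply: (@product_le2 _ C K (fun n => cabs (k n) + B)) => //.
  - exact: CK.
  - by move=> p; rewrite addr_ge0 ?cabs_ge0.
  move=> p Kp; have := kstep p Kp.
  have := cabsB_ge (k p.+1) (k p).
  by move: (C / (p%:R * p.+1%:R)) => x; rewrite mulrDl mul1r; lra.
have M0 : 0 <= M by rewrite mulr_ge0 ?addr_ge0 ?cabs_ge0.
have kcauchy n p : (K <= n)%N -> (n <= p)%N -> cabs (k p - k n) <= M * (C / n%:R - C / p%:R).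
  move=> Kn; elim: p => [|p IH]; first by rewrite leqn0 => /eqP ->; rewrite !subrr cabs0 mulr0.
  rewrite leq_eqVlt => /orP[/eqP <-|]; first by rewrite !subrr cabs0 mulr0.
  rewrite ltnS => np; have Kp := leq_trans Kn np.
  have -> : k p.+1 - k n = (k p.+1 - k p) + (k p - k n) by rewrite addrA subrK.
  apply: le_trans (cabsD _ _) _.
  have h1 := IH np.
  have h2 : cabs (k p.+1 - k p) <= M * (C / p%:R - C / p.+1%:R).
    apply: le_trans (kstep p Kp) _.
    rewrite -mulrBr -inv_mulSE; last exact: leq_trans Kp.
    by rewrite mulrC ler_wpM2r ?kM // divr_ge0 ?mulr_ge0.
  move: h1 h2; rewrite !mulrBr.
  move: (M * (C / n%:R)) (M * (C / p%:R)) (M * (C / p.+1%:R)) => x y z h1 h2.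
  by lra.
move=> eps eps0.
have e3 : 0 < eps / 6 by rewrite divr_gt0.
have [n1 hn1] : exists n1, forall p q, (n1 <= p)%N -> (n1 <= q)%N ->
    cabs (beta * (S p - S q)) <= eps / 6.
  have [n1 hn1] := cvgn_cauchy cvgt (divr_gt0 e3 (ltr_pwDl ltr01 (cabs_ge0 beta))).
  exists n1 => p q hp hq; rewrite cabsM.
  have b1 : 0 < 1 + cabs beta by rewrite ltr_pwDl ?cabs_ge0.
  have := hn1 p q hp hq; rewrite ler_pdivlMr //.
  by have := cabs_ge0 (S p - S q); nra.
have [n2 hn2] := cvgn_cauchy cvgt ltr01.
have MC0 : 0 <= M * C by rewrite mulr_ge0.
(* from n on, g varies by at most eps / 3 and S by at most 1 *)
have [n [n0 nK hn]] := exists_index_ge (maxn K (maxn n1 n2)) MC0 e3.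
move: nK; rewrite !geq_max => /and3P[Kn n1n n2n].
have gcauchy p : (n <= p)%N -> cabs (g p - g n) <= eps / 3.
  move=> np.
  have -> : g p - g n = (k p - k n) + beta * (S p - S n) by rewrite /k; ring.
  apply: le_trans (cabsD _ _) _.
  have := kcauchy n p Kn np; have := hn1 p n (leq_trans n1n np) n1n.
  have : 0 <= M * (C / p%:R) by rewrite mulr_ge0 // divr_ge0.
  have := hn n (leqnn _).
  by lra.
suff gn : cabs (g n) <= 2 * (eps / 3).
  exists n => p np; have := gcauchy p np.
  by have := cabsB_ge (g p) (g n); lra.
rewrite leNgt; apply/negP => gn.
have [p [np hp]] := harmonic_unbounded (3 / eps) n0.
have := hn2 p n (leq_trans n2n np) n2n.
rewrite Sdiff //.
set H := \sum_(n <= j < p) j%:R^-1 in hp.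
have E : \sum_(n <= j < p) t j
    = g n * (\sum_(n <= j < p) j%:R^-1) + \sum_(n <= j < p) (g j - g n) / j%:R.
  rewrite mulr_sumr -big_split /=; apply: eq_big_nat => j /andP[nj _].
  rewrite -mulrDl addrC subrK gE mulrC mulKf //.
  by rewrite pnatr_eq0 -lt0n (leq_trans n0).
have HE : cabs (\sum_(n <= j < p) (j%:R^-1 : R[i])) = H.
  have -> : \sum_(n <= j < p) (j%:R^-1 : R[i]) = (H%:C)%C.
    by rewrite rmorph_sum; apply: eq_bigr => j _; rewrite fmorphV rmorph_nat.
  have H0 : 0 <= H by apply: sumr_ge0 => j _; rewrite invr_ge0.
  exact: cabs_real.
have H2 : cabs (\sum_(n <= j < p) (g j - g n) / j%:R) <= eps / 3 * H.
  apply: le_trans (cabs_sum _ _ _) _; rewrite mulr_sumr !big_nat.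
  apply: ler_sum => j /andP[nj _].
  by rewrite cabsM cabsV cabs_nat ler_wpM2r ?invr_ge0 ?gcauchy.
have := cabsB_ge (\sum_(n <= j < p) t j) (\sum_(n <= j < p) (g j - g n) / j%:R).
have := cabsB_ge (g n * (\sum_(n <= j < p) j%:R^-1)) (- \sum_(n <= j < p) (g j - g n) / j%:R).
rewrite opprK -E cabsM HE cabsN => h1 _ h2.
have h3 : 1 < eps / 3 * H.
  by rewrite mulrC -ltr_pdivrMr ?divr_gt0 // div1r invf_div.
have h4 : 0 <= (cabs (g n) - 2 * (eps / 3)) * H.
  rewrite mulr_ge0 ?subr_ge0 ?ltW //.
  by apply: lt_trans hp; rewrite divr_gt0.
by lra.
Qed.

(** Since 1 + k/n >= 1, the modulus of g can only decrease through the factors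
    1 - O(1/n^2), whose product is bounded below: a nonzero value of g at a
    large index keeps g away from 0. *)
Lemma slowly_varying_eq0 (k : nat) :
    (forall n, (K0 <= n)%N -> cabs (g n.+1 - (1 + k%:R / n%:R) * g n)
       <= C / (n%:R * n.+1%:R) * cabs (g n)) ->
    (forall eps, 0 < eps -> exists n0, forall n, (n0 <= n)%N -> cabs (g n) <= eps) ->
  exists2 n, (0 < n)%N & g n = 0.
Proof.
move=> hg g0.
have [K [Kpos K0K CK]] := exists_index_ge K0 C0 (ltac:(by rewrite invr_gt0) : 0 < 2^-1 :> R).
exists K => //; apply/eqP; apply: contraT; rewrite -cabs_gt0 => gK.
have [n0 hn0] := g0 _ (ltac:(by rewrite divr_gt0) : 0 < cabs (g K) / 4).
have := hn0 (maxn n0 K) (leq_maxl _ _).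
have : cabs (g K) <= 2 * cabs (g (maxn n0 K)).
  apply: (@product_ge2 _ C K (fun n => cabs (g n))) (leq_maxr _ _) => //.
  - exact: CK.
  - by move=> n; apply: cabs_ge0.
  move=> n Kn.
  have := hg n (leq_trans K0K Kn).
  have := cabsB_ge ((1 + k%:R / n%:R) * g n) ((1 + k%:R / n%:R) * g n - g n.+1).
  rewrite subKr cabs_distC.
  move: (C / (n%:R * n.+1%:R)) => x; rewrite mulrBl mul1r.
  have : cabs (g n) <= cabs ((1 + k%:R / n%:R) * g n).
    rewrite cabsM ler_peMl ?cabs_ge0 //.
    have -> : 1 + k%:R / n%:R = (1 + k%:R / n%:R : R)%:C%C.
      by rewrite rmorphD rmorph1 fmorph_div !rmorph_nat.
    by rewrite cabs_real ?lerDl ?addr_ge0 ?divr_ge0.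
  by lra.
by lra.
Qed.

End SlowlyVarying.

(** * Terms and boundary terms of a convergent series *)

Section Asymptotics.
Variable R : realType.
Implicit Types a b c d e f x z : R[i].

Lemma cabs_addn_le z n : (0 < n)%N -> cabs (z + n%:R) <= (cabs z + 1) * n%:R.
Proof.
move=> n0; apply: le_trans (cabsD _ _) _; rewrite cabs_nat mulrDl mul1r lerD2r.
by rewrite ler_peMr ?cabs_ge0 // ler1n.
Qed.

Lemma cabs_addn_ge z : exists K, forall n, (K <= n)%N -> n%:R / 2 <= cabs (z + n%:R).
Proof.
have [K [K0 _ hK]] := @exists_index_ge R (cabs z) (2^-1) 0 (cabs_ge0 _)
  (ltac:(by rewrite invr_gt0)).
exists K => n Kn; have n0 : 0 < n%:R :> R by rewrite ltr0n (leq_trans K0).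
have := hK n Kn; rewrite ler_pdivrMr // => h.
by have := cabsB_ge n%:R (- z); rewrite opprK cabsN cabs_nat addrC [n%:R + z]addrC; lra.
Qed.

(** The certificate has degree at most n-1 in x, and is 0 for n = 0; the factor
    1 + cabs x on the left makes one formula of the two cases. *)
Lemma certificate_bound n a b c d e f : exists2 C : R, 0 <= C &
  forall x, cabs (certificate n a b c d e f x) * (1 + cabs x) <= C * (1 + cabs x) ^+ n.
Proof.
elim: n a b c d e f => [|n IH] a b c d e f.
  by exists 0 => // x; rewrite cabs0 !mul0r.
have [C0 C0ge h0] := IH a b c d e f.
have [C1 C1ge h1] := IH (a + 1) (b + 1) (c + 1) (d + 1) (e + 1) (f + 1).
rewrite /=; set r := _.2 / (_ * f).
exists (C0 + C1 * 2 ^+ n.+1 / cabs f + cabs r).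
  by rewrite !addr_ge0 ?divr_ge0 ?mulr_ge0 ?cabs_ge0 ?exprn_ge0.
move=> x; set y := 1 + cabs x.
have y1 : 1 <= y by rewrite lerDl cabs_ge0.
have y0 : 0 <= y by apply: le_trans y1.
have hp0 := h0 x; have hp1 := h1 (x - 1).
set p0 := certificate n a _ _ _ _ _ _ in hp0 *.
set p1 := certificate n (a + 1) _ _ _ _ _ _ in hp1 *.
set y' := 1 + cabs (x - 1) in hp1.
have y'1 : 1 <= y' by rewrite lerDl cabs_ge0.
have yy' : y <= 2 * y'.
  have := cabsD (x - 1) 1; rewrite subrK (@Normc.normc1 R) => h.
  by have := cabs_ge0 (x - 1); rewrite /y /y'; lra.
have y'y : y' <= 2 * y.
  have := cabsB x 1; rewrite (@Normc.normc1 R) => h.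
  by have := cabs_ge0 x; rewrite /y /y'; lra.
have cx : cabs x <= y by rewrite lerDr.
have hp1' : cabs p1 * y <= C1 * 2 ^+ n.+1 * y ^+ n.
  apply: le_trans (_ : 2 * (cabs p1 * y') <= _).
    by rewrite mulrCA ler_wpM2l ?cabs_ge0.
  have -> : C1 * 2 ^+ n.+1 * y ^+ n = 2 * (C1 * (2 * y) ^+ n).
    by rewrite exprS exprMn; ring.
  rewrite ler_pM2l //; apply: le_trans hp1 _; rewrite ler_wpM2l // lerXn2r ?nnegrE //.
    by apply: le_trans y'1.
  by rewrite mulr_ge0.
have part1 : cabs p0 * y <= C0 * y ^+ n.+1.
  apply: le_trans hp0 _; rewrite ler_wpM2l // exprS ler_peMl ?exprn_ge0 //.
have part2 : cabs (x * p1 / f) * y <= C1 * 2 ^+ n.+1 / cabs f * y ^+ n.+1.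
  rewrite !cabsM cabsV; set F := (cabs f)^-1.
  have F0 : 0 <= F by rewrite invr_ge0 cabs_ge0.
  have -> : cabs x * cabs p1 * F * y = cabs x * (cabs p1 * y) * F by ring.
  have -> : C1 * 2 ^+ n.+1 * F * y ^+ n.+1 = y * (C1 * 2 ^+ n.+1 * y ^+ n) * F.
    by rewrite [y ^+ n.+1]exprS; ring.
  by rewrite ler_wpM2r // ler_pM ?mulr_ge0 ?cabs_ge0.
have part3 : cabs r * y <= cabs r * y ^+ n.+1.
  by rewrite ler_wpM2l ?cabs_ge0 // exprS ler_peMr // exprn_ege1.
apply: le_trans (_ : (cabs p0 + cabs (x * p1 / f) + cabs r) * y <= _).
  rewrite ler_wpM2r //; apply: le_trans (cabsB _ _) _; rewrite lerD2r.
  exact: cabsD.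
by rewrite !mulrDl !lerD.
Qed.

Variables (a b c d e f : R[i]) (m : nat).
Hypothesis (d0 : forall i, d + i%:R != 0) (e0 : forall i, e + i%:R != 0).

Let t n := term a b c d e n * (rising (f + n%:R) m / rising f m).

Lemma polyterm_ratio n :
  t n.+1 * (n.+1%:R * (d + n%:R) * (e + n%:R) * (f + n%:R))
    = t n * ((a + n%:R) * (b + n%:R) * (c + n%:R) * (f + m%:R + n%:R)).
Proof.
have h : rising (f + n.+1%:R) m * (f + n%:R) = rising (f + n%:R) m * (f + m%:R + n%:R).
  rewrite -natr1 addrA mulrC -rising_shift risingS; congr (_ * _).
  by rewrite addrAC.
have := termS a b c (d0 n) (e0 n); rewrite /t => hT.
transitivity (term a b c d e n.+1 * (n.+1%:R * (d + n%:R) * (e + n%:R)) *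
   (rising (f + n.+1%:R) m * (f + n%:R)) / rising f m); first by ring.
by rewrite hT h; ring.
Qed.

(** The ratio of n.+1 * t n.+1 and n * t n is a quotient of two polynomials of
    degree 4 in n; beta is chosen so that the numerator minus (n + beta) times
    the cubic factor D of the denominator is only quadratic in n. *)
Lemma polyterm_slowly_varying : exists2 C : R, 0 <= C & exists K0, forall n, (K0 <= n)%N ->
  cabs (n.+1%:R * t n.+1 - n%:R * t n - (a + b + c + m%:R - d - e) * t n)
    <= C / (n%:R * n.+1%:R) * cabs (n%:R * t n).
Proof.
have [Kd hd] := cabs_addn_ge d.
have [Ke he] := cabs_addn_ge e.
have [Kf hf] := cabs_addn_ge f.
pose phi := f + m%:R; pose beta := a + b + c + m%:R - d - e.
(* q2, q1, q0 are the coefficients of that quadratic polynomial *)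
pose q2 := a*b+a*c+a*phi+b*c+b*phi+c*phi - (d*e+d*f+e*f) - beta*(d+e+f).
pose q1 := a*b*c+a*b*phi+a*c*phi+b*c*phi - d*e*f - beta*(d*e+d*f+e*f).
pose q0 := a*b*c*phi - beta*d*e*f.
pose Q := cabs q2 + cabs q1 + cabs q0.
have Q0 : 0 <= Q by rewrite !addr_ge0 ?cabs_ge0.
exists (16 * Q); first by rewrite mulr_ge0.
exists (maxn 1 (maxn Kd (maxn Ke Kf))) => n.
rewrite !geq_max => /and4P[n0 /hd hdn /he hen /hf hfn].
pose D := (d + n%:R) * (e + n%:R) * (f + n%:R).
set u := _ - _ - _.
have uE : u * D = t n * (q2 * n%:R ^+ 2 + q1 * n%:R + q0).
  have := polyterm_ratio n.
  rewrite /u /D => h.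
  transitivity (t n.+1 * (n.+1%:R * (d + n%:R) * (e + n%:R) * (f + n%:R))
     - (n%:R + beta) * t n * ((d + n%:R) * (e + n%:R) * (f + n%:R))).
    rewrite /beta; ring.
  by rewrite h /q2 /q1 /q0 /beta /phi; ring.
have nR : 1 <= n%:R :> R by rewrite ler1n.
have D8 : n%:R ^+ 3 / 8 <= cabs D.
  rewrite /D !cabsM.
  have -> : n%:R ^+ 3 / 8 = (n%:R / 2) * (n%:R / 2) * (n%:R / 2) :> R by field.
  by rewrite !ler_pM ?mulr_ge0 ?divr_ge0.
have hq : cabs (q2 * n%:R ^+ 2 + q1 * n%:R + q0) <= Q * n%:R ^+ 2.
  apply: le_trans (cabsD _ _) _; apply: le_trans (lerD (cabsD _ _) (lexx _)) _.
  rewrite expr2 !cabsM !cabs_nat.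
  have h1 : 0 <= cabs q1 * (n%:R * n%:R - n%:R).
    by rewrite mulr_ge0 ?cabs_ge0 // subr_ge0 ler_peMl.
  have h0 : 0 <= cabs q0 * (n%:R * n%:R - 1).
    by rewrite mulr_ge0 ?cabs_ge0 // subr_ge0 mulr_ege1.
  by rewrite /Q; lra.
have h1 : cabs u * (n%:R ^+ 3 / 8) <= cabs (t n) * (Q * n%:R ^+ 2).
  apply: le_trans (_ : cabs u * cabs D <= _); first by rewrite ler_wpM2l ?cabs_ge0.
  by rewrite -cabsM uE cabsM ler_wpM2l ?cabs_ge0.
have n3 : 0 < n%:R :> R by apply: lt_le_trans nR.
rewrite cabsM cabs_nat.
have -> : 16 * Q / (n%:R * n.+1%:R) * (n%:R * cabs (t n)) = 16 * Q * cabs (t n) / n.+1%:R.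
  have n1 : n.+1%:R != 0 :> R by rewrite pnatr_eq0.
  by move: n.+1%:R n1 => N1 n1; field; rewrite n1 gt_eqF.
rewrite ler_pdivlMr ?ltr0n //.
have h2 : cabs u * n%:R <= 8 * Q * cabs (t n).
  rewrite -(ler_pM2r (exprn_gt0 2 n3)).
  by move: h1; rewrite exprS; lra.
apply: le_trans (_ : cabs u * (2 * n%:R) <= _).
  by rewrite ler_wpM2l ?cabs_ge0 // -natr1; lra.
by lra.
Qed.

End Asymptotics.

Section Nonterminating.
Variable R : realType.

Lemma rising_ge (f : R[i]) m : exists K, forall n, (K <= n)%N ->
  (n%:R / 2) ^+ m <= cabs (rising (f + n%:R) m).
Proof.
have [K hK] := cabs_addn_ge f.
exists K => n Kn; elim: m => [|m IH].
  by rewrite /rising big_ord0 (@Normc.normc1 R).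
rewrite exprSr risingS cabsM ler_pM ?exprn_ge0 ?divr_ge0 //.
rewrite -addrA -natrD; apply: le_trans (hK _ (leq_trans Kn (leq_addr _ _))).
by rewrite ler_pM2r ?invr_gt0 // ler_nat leq_addr.
Qed.

Variables (a b c d e f : R[i]) (n : nat).
Hypothesis (d0 : forall i, d + i%:R != 0) (e0 : forall i, e + i%:R != 0)
  (f0 : forall i, f + i%:R != 0).

Let t k : R[i]^o := term a b c d e k * (rising (f + k%:R) n.+1 / rising f n.+1).

(** The boundary term grows like T_N N^(m+1), that is like N t_N: the three
    factors N, d+N-1, e+N-1 and a certificate of degree m-2 against the factor
    N and the polynomial (f+N)_m of degree m. *)
Lemma boundary_le : exists M, exists K, 0 <= M /\ forall N, (K <= N)%N ->
  cabs (term a b c d e N * (N%:R * (d + N%:R - 1) * (e + N%:R - 1))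
        * certificate n a b c d e f (N%:R - 1)) <= M * cabs (N%:R * t N).
Proof.
have [K hK] := rising_ge f n.+1.
have [C C0 hC] := certificate_bound n a b c d e f.
pose Dd := cabs (d - 1) + 1; pose De := cabs (e - 1) + 1.
have Dd0 : 0 <= Dd by rewrite addr_ge0 ?cabs_ge0.
have De0 : 0 <= De by rewrite addr_ge0 ?cabs_ge0.
pose R0 := cabs (rising f n.+1).
have R0gt : 0 < R0 by rewrite cabs_gt0 rising_neq0.
exists (Dd * De * C * 2 ^+ n.+1 * R0), (maxn 1 K); split.
  by rewrite !mulr_ge0 ?exprn_ge0 // ltW.
move=> N; rewrite geq_max => /andP[N0 /hK hN].
have Ngt : 0 < N%:R :> R by rewrite ltr0n.
set T := cabs (term a b c d e N).
have T0 : 0 <= T by apply: cabs_ge0.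
have hg : T * N%:R ^+ n.+2 <= 2 ^+ n.+1 * R0 * cabs (N%:R * t N).
  rewrite cabsM cabs_nat /t [cabs (term _ _ _ _ _ _ * _)]cabsM -/T cabsM cabsV -/R0.
  have -> : 2 ^+ n.+1 * R0 * (N%:R * (T * (cabs (rising (f + N%:R) n.+1) / R0))) =
     T * N%:R * (2 ^+ n.+1 * cabs (rising (f + N%:R) n.+1)).
    by move: (cabs _) => x; field; rewrite gt_eqF.
  rewrite exprS mulrA ler_wpM2l ?mulr_ge0 //.
  have -> : N%:R ^+ n.+1 = 2 ^+ n.+1 * (N%:R / 2) ^+ n.+1 :> R.
    by rewrite -exprMn mulrC divfK.
  by rewrite ler_wpM2l ?exprn_ge0.
have hcert : N%:R * cabs (certificate n a b c d e f (N%:R - 1)) <= C * N%:R ^+ n.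
  have := hC (N%:R - 1).
  have -> : N%:R - 1 = N.-1%:R :> R[i] by rewrite -[in LHS](prednK N0) -natr1 addrK.
  by rewrite cabs_nat nat1r prednK // mulrC.
rewrite cabsM cabsM -/T cabsM cabsM cabs_nat.
have hd : cabs (d + N%:R - 1) <= Dd * N%:R.
  by rewrite addrAC cabs_addn_le.
have he : cabs (e + N%:R - 1) <= De * N%:R.
  by rewrite addrAC cabs_addn_le.
set P := cabs (certificate _ _ _ _ _ _ _ _) in hcert *.
apply: le_trans (_ : T * ((Dd * N%:R) * (De * N%:R)) * (N%:R * P) <= _).
  have -> : T * (N%:R * cabs (d + N%:R - 1) * cabs (e + N%:R - 1)) * P =
    T * (cabs (d + N%:R - 1) * cabs (e + N%:R - 1)) * (N%:R * P) by ring.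
  rewrite ler_wpM2r ?mulr_ge0 ?cabs_ge0 ?ler0n // ler_wpM2l //.
  by rewrite ler_pM ?cabs_ge0.
apply: le_trans (_ : T * ((Dd * N%:R) * (De * N%:R)) * (C * N%:R ^+ n) <= _).
  by rewrite ler_wpM2l // !mulr_ge0.
have -> : T * (Dd * N%:R * (De * N%:R)) * (C * N%:R ^+ n) =
   Dd * De * C * (T * N%:R ^+ n.+2) by rewrite !exprS; ring.
rewrite -(mulrA (Dd * De * C)) -[X in _ <= X]mulrA.
by rewrite ler_wpM2l ?mulr_ge0.
Qed.

Hypothesis (a0 : forall i, a + i%:R != 0) (b0 : forall i, b + i%:R != 0)
  (c0 : forall i, c + i%:R != 0).
Hypothesis cvgt : cvgn (series t).

Lemma polyterm_decay eps : 0 < eps ->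
  exists n0, forall k, (n0 <= k)%N -> cabs (k%:R * t k) <= eps.
Proof.
have [C C0 [K0 hK]] := polyterm_slowly_varying a b c f n.+1 d0 e0.
exact: (@slowly_varying_cvg0 _ (fun k => k%:R * t k) C K0 C0 t _ cvgt (fun=> erefl) hK).
Qed.

Lemma boundary_cvg0 :
  ((fun N => term a b c d e N * (N%:R * (d + N%:R - 1) * (e + N%:R - 1))
     * certificate n a b c d e f (N%:R - 1) : R[i]^o) @ \oo --> (0 : R[i]^o))%classic.
Proof.
have [M [K [M0 hM]]] := boundary_le.
apply/cvgn_cabsP => eps eps0.
have M1 : 0 < M + 1 by rewrite ltr_wpDl.
have [n0 hn0] := polyterm_decay (divr_gt0 eps0 M1).
exists (maxn K n0) => N; rewrite geq_max => /andP[/hM h1 /hn0 h2].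
rewrite subr0; apply: le_trans h1 _.
move: h2; rewrite ler_pdivlMr //.
by have := cabs_ge0 (N%:R * t N); lra.
Qed.

(** If s = i+1 with i < n then beta = n - (i+1) is a natural number, and the
    decay of k t_k would force some t_k to be 0, which is excluded when none of
    a, b, c is a nonpositive integer. *)
Lemma excess_neq_nat i : (i < n)%N -> excess a b c d e - i.+1%:R != 0.
Proof.
move=> ltin; apply/eqP => sE.
have [C C0 [K0 hK]] := polyterm_slowly_varying a b c f n.+1 d0 e0.
have betaE : a + b + c + n.+1%:R - d - e = (n - i.+1)%:R.
  have -> : a + b + c + n.+1%:R - d - e =
      n%:R - i.+1%:R - (excess a b c d e - i.+1%:R).
    by rewrite /excess -natr1; ring.
  by rewrite sE subr0 natrB.
have [||k k0] := @slowly_varying_eq0 _ (fun k => k%:R * t k) C (maxn 1 K0) C0 (n - i.+1).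
- move=> k; rewrite geq_max => /andP[k0 /hK].
  rewrite betaE => h.
  have k1 : k%:R != 0 :> R[i] by rewrite pnatr_eq0 -lt0n.
  suff -> : k.+1%:R * t k.+1 - (1 + (n - i.+1)%:R / k%:R) * (k%:R * t k)
    = k.+1%:R * t k.+1 - k%:R * t k - (n - i.+1)%:R * t k by exact: h.
  by rewrite mulrDl mul1r [_ / _ * (_ * _)]mulrA divfK // opprD addrA.
- exact: polyterm_decay.
apply/eqP; rewrite mulf_eq0 negb_or pnatr_eq0 -lt0n k0 /=.
rewrite /t /term !mulf_neq0 ?invr_eq0 ?mulf_neq0 ?rising_neq0 //.
by move=> j _; rewrite -addrA -natrD.
Qed.

End Nonterminating.

(** * Shift and values of rational functions *)

Section RationalFunctions.
Variable R : realType.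
Implicit Types (p q : poly6 R) (x y : ratfun6 R) (v : 'I_6 -> R[i]).
Local Notation tofrac := (@FracField.tofrac (poly6 R)).

Lemma frac_reprE x :
  x = tofrac (fraction.frac (repr x)).1 / tofrac (fraction.frac (repr x)).2.
Proof.
have d0 : tofrac (fraction.frac (repr x)).2 != 0.
  by rewrite tofrac_eq0 denom_ratioP.
apply: (canRL (mulfK d0)); rewrite -{1}[x]reprK; unlock FracField.tofrac.
rewrite -[LHS]FracField.pi_mul; apply/eqmodP => /=.
by rewrite FracField.equivfE /FracField.mulf !numden_Ratio ?oner_eq0 ?mulr1 ?denom_ratioP // mulrC.
Qed.

Lemma tofrac_neq0 p : p != 0 -> tofrac p != 0.
Proof. by rewrite tofrac_eq0. Qed.

Lemma frac_eqP p q p' q' : q != 0 -> q' != 0 ->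
  (tofrac p / tofrac q = tofrac p' / tofrac q') <-> (p * q' = p' * q).
Proof.
move=> /tofrac_neq0 q0 /tofrac_neq0 q0'; split=> [/eqP|E]; last apply/eqP;
  rewrite (eqr_div _ _ q0 q0') -!tofracM.
  by rewrite tofrac_eq => /eqP.
by rewrite E.
Qed.

Lemma frac_add p q p' q' : q != 0 -> q' != 0 ->
  tofrac p / tofrac q + tofrac p' / tofrac q' = tofrac (p * q' + p' * q) / tofrac (q * q').
Proof.
move=> /tofrac_neq0 q0 /tofrac_neq0 q0'.
by rewrite (addf_div _ _ q0 q0') tofracD !tofracM.
Qed.

Lemma frac_mul p q p' q' :
  (tofrac p / tofrac q) * (tofrac p' / tofrac q') = tofrac (p * p') / tofrac (q * q').
Proof. by rewrite mulf_div !tofracM. Qed.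

Lemma frac_opp p q : - (tofrac p / tofrac q) = tofrac (- p) / tofrac q.
Proof. by rewrite tofracN mulNr. Qed.

Lemma fracP x : exists p q, q != 0 /\ x = tofrac p / tofrac q.
Proof.
exists (fraction.frac (repr x)).1, (fraction.frac (repr x)).2.
by split; [apply: denom_ratioP | apply: frac_reprE].
Qed.

(** Substituting X_i - 1 for X_i undoes the shift. *)
Lemma pshift_inj : injective (@pshift R).
Proof.
pose T := [tuple pvar R i - 1 | i < 6].
apply: (can_inj (g := mpoly.comp_mpoly T)) => p.
rewrite [RHS]mpoly.mpolyE /pshift [mpoly.comp_mpoly _ p]mpoly.comp_mpolyEX raddf_sum /=.
apply: eq_bigr => m _; rewrite mpoly.comp_mpolyZ mpoly.comp_mpolyX rmorph_prod /=.
congr (_ *: _); rewrite mpoly.mpolyXE_id; apply: eq_bigr => i _.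
rewrite rmorphXn /=; congr (_ ^+ _).
by rewrite tnth_mktuple rmorphD rmorph1 /= mpoly.comp_mpolyXU nth_mktuple subrK.
Qed.

Lemma pshiftM : {morph @pshift R : p q / p * q}.
Proof. by move=> p q; rewrite /pshift rmorphM. Qed.

Lemma pshiftD : {morph @pshift R : p q / p + q}.
Proof. by move=> p q; rewrite /pshift rmorphD. Qed.

Lemma pshiftN : {morph @pshift R : p / - p}.
Proof. by move=> p; rewrite /pshift rmorphN. Qed.

Lemma pshift_neq0 p : p != 0 -> pshift p != 0.
Proof.
apply: contra => /eqP h; apply/eqP/pshift_inj; by rewrite h /pshift raddf0.
Qed.

(** The shift may be computed on any fraction, not only on the chosen
    representative, because it maps nonzero denominators to nonzero ones. *)
Lemma rfshift_frac p q : q != 0 ->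
  rfshift (tofrac p / tofrac q) = tofrac (pshift p) / tofrac (pshift q).
Proof.
move=> q0; rewrite /rfshift; set x := tofrac p / _.
have xE := frac_reprE x; have dx := denom_ratioP (repr x).
move: (fraction.frac _).1 (fraction.frac _).2 xE dx => n d xE d0.
apply/(frac_eqP _ _ (pshift_neq0 d0) (pshift_neq0 q0)).
have /(frac_eqP _ _ d0 q0)/(congr1 (@pshift R)) := esym xE.
by rewrite !pshiftM.
Qed.

Lemma rfshift_zmod_morphism : zmod_morphism (@rfshift R).
Proof.
move=> x y; have [p [q [q0 ->]]] := fracP x; have [p' [q' [q0' ->]]] := fracP y.
rewrite frac_opp (frac_add _ _ q0 q0') (rfshift_frac _ (mulf_neq0 q0 q0')).
rewrite (rfshift_frac _ q0) (rfshift_frac _ q0').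
rewrite [RHS](f_equal2 +%R erefl (frac_opp (pshift p') (pshift q'))).
rewrite (frac_add _ _ (pshift_neq0 q0) (pshift_neq0 q0')).
by rewrite pshiftD !pshiftM pshiftN.
Qed.

Lemma rfshift_monoid_morphism : monoid_morphism (@rfshift R).
Proof.
split=> [|x y].
  have -> : 1 = tofrac 1 / tofrac 1 by rewrite tofrac1 divr1.
  by rewrite rfshift_frac ?oner_neq0 // /pshift rmorph1.
have [p [q [q0 ->]]] := fracP x; have [p' [q' [q0' ->]]] := fracP y.
rewrite frac_mul (rfshift_frac _ (mulf_neq0 q0 q0')) (rfshift_frac _ q0) (rfshift_frac _ q0').
by rewrite frac_mul !pshiftM.
Qed.

HB.instance Definition _ := GRing.isZmodMorphism.Build (ratfun6 R) (ratfun6 R)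
  (@rfshift R) rfshift_zmod_morphism.
HB.instance Definition _ := GRing.isMonoidMorphism.Build (ratfun6 R) (ratfun6 R)
  (@rfshift R) rfshift_monoid_morphism.

Lemma rfshift_var i : rfshift (rfvar R i) = rfvar R i + 1.
Proof.
have -> : rfvar R i = tofrac (pvar R i) / tofrac 1 by rewrite tofrac1 divr1.
rewrite rfshift_frac ?oner_neq0 // /pshift rmorph1 tofrac1 !divr1.
by rewrite mpoly.comp_mpolyXU nth_mktuple tofracD tofrac1.
Qed.

Lemma meval_neq0 v q : mpoly.meval v q != 0 -> q != 0.
Proof. by apply: contra_neq => ->; rewrite raddf0. Qed.

Lemma rfvalue_unique x v (y1 y2 : R[i]) : rfvalue x v y1 -> rfvalue x v y2 -> y1 = y2.
Proof.
move=> [p1 [q1 [-> h1 ->]]] [p2 [q2 [E h2 ->]]].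
move/(frac_eqP _ _ (meval_neq0 h1) (meval_neq0 h2)): E => E.
by apply/eqP; rewrite eqr_div // -!rmorphM E.
Qed.

Lemma rfvalue_poly p v : rfvalue (tofrac p) v (mpoly.meval v p).
Proof. by exists p, 1; rewrite tofrac1 rmorph1 !divr1 oner_neq0. Qed.

Lemma rfvalue_var i v : rfvalue (rfvar R i) v (v i).
Proof. by have := rfvalue_poly (pvar R i) v; rewrite mpoly.mevalXU. Qed.

Lemma rfvalue1 v : rfvalue 1 v 1.
Proof. by have := rfvalue_poly 1 v; rewrite tofrac1 rmorph1. Qed.

Lemma rfvalue0 v : rfvalue 0 v 0.
Proof. by have := rfvalue_poly 0 v; rewrite tofrac0 rmorph0. Qed.

Lemma rfvalueD x y v (x' y' : R[i]) :
  rfvalue x v x' -> rfvalue y v y' -> rfvalue (x + y) v (x' + y').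
Proof.
move=> [p1 [q1 [-> h1 ->]]] [p2 [q2 [-> h2 ->]]].
exists (p1 * q2 + p2 * q1), (q1 * q2); split.
- exact: frac_add (meval_neq0 h1) (meval_neq0 h2).
- by rewrite rmorphM mulf_neq0.
- by rewrite rmorphD !rmorphM addf_div.
Qed.

Lemma rfvalueN x v (x' : R[i]) : rfvalue x v x' -> rfvalue (- x) v (- x').
Proof. by move=> [p [q [-> h ->]]]; exists (- p), q; rewrite frac_opp mpoly.mevalN mulNr. Qed.

Lemma rfvalueB x y v (x' y' : R[i]) :
  rfvalue x v x' -> rfvalue y v y' -> rfvalue (x - y) v (x' - y').
Proof. by move=> hx /rfvalueN; apply: rfvalueD. Qed.

Lemma rfvalueM x y v (x' y' : R[i]) :
  rfvalue x v x' -> rfvalue y v y' -> rfvalue (x * y) v (x' * y').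
Proof.
move=> [p1 [q1 [-> h1 ->]]] [p2 [q2 [-> h2 ->]]].
by exists (p1 * p2), (q1 * q2); rewrite frac_mul !mpoly.mevalM mulf_neq0 // mulf_div.
Qed.

Lemma rfvalueV x v (x' : R[i]) : x' != 0 -> rfvalue x v x' -> rfvalue x^-1 v x'^-1.
Proof.
move=> x0 [p [q [-> h E]]]; exists q, p; rewrite E !invf_div; split=> //.
by apply: contra_neq x0; rewrite E => ->; rewrite mul0r.
Qed.

Lemma rfvalue_div x y v (x' y' : R[i]) : y' != 0 ->
  rfvalue x v x' -> rfvalue y v y' -> rfvalue (x / y) v (x' / y').
Proof. by move=> y0 hx hy; apply: rfvalueM => //; apply: rfvalueV. Qed.

Lemma rfvalue_neq0 x v (x' : R[i]) : x' != 0 -> rfvalue x v x' -> x != 0.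
Proof.
move=> x0 h; apply: contra_neq x0 => xE; rewrite xE in h.
exact: rfvalue_unique h (rfvalue0 v).
Qed.

(** Regularity is propagated through the recursion, which divides only by the
    factors assumed to be nonzero at the point. *)
Lemma rfvalue_reduction n (xa xb xc xd xe xf : ratfun6 R) v (a b c d e f : R[i]) :
    rfvalue xa v a -> rfvalue xb v b -> rfvalue xc v c ->
    rfvalue xd v d -> rfvalue xe v e -> rfvalue xf v f ->
    (forall i, (i <= n)%N -> f + i%:R != 0) ->
    (forall i, (i < n)%N -> excess a b c d e - i.+1%:R != 0) ->
  rfvalue (reduction n xa xb xc xd xe xf).1 v (reduction n a b c d e f).1 /\
  rfvalue (reduction n xa xb xc xd xe xf).2 v (reduction n a b c d e f).2.
Proof.
have S x (x' : R[i]) : rfvalue x v x' -> rfvalue (x + 1) v (x' + 1).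
  by move=> hx; apply: rfvalueD => //; apply: rfvalue1.
have v1 := rfvalue1 v.
elim: n xa xb xc xd xe xf a b c d e f => [|n IH] xa xb xc xd xe xf a b c d e f
  ha hb hc hd he hf f0 s0 /=.
  by have := f0 0%N isT; rewrite addr0 => hf0; split; [apply: rfvalue1|apply: rfvalueV].
have f0' : f != 0 by have := f0 0%N isT; rewrite addr0.
have s1 : excess a b c d e - 1 != 0 by apply: (s0 0%N).
have [A0 B0] := IH _ _ _ _ _ _ _ _ _ _ _ _ ha hb hc hd he hf
  (fun i h => f0 i (leqW h)) (fun i h => s0 i (leqW h)).
have f1 i : (i <= n)%N -> f + 1 + i%:R != 0 by move=> hi; rewrite shiftD; apply: f0.
have s2 i : (i < n)%N ->
    excess (a + 1) (b + 1) (c + 1) (d + 1) (e + 1) - i.+1%:R != 0.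
  by move=> hi; rewrite excess_shift -addrA -opprD nat1r; apply: s0.
have [A1 B1] := IH _ _ _ _ _ _ _ _ _ _ _ _ (S _ _ ha) (S _ _ hb) (S _ _ hc)
  (S _ _ hd) (S _ _ he) (S _ _ hf) f1 s2.
have sv : rfvalue (excess xa xb xc xd xe - 1) v (excess a b c d e - 1).
  by rewrite /excess; do ![apply: rfvalueB => // | apply: rfvalueD => //].
have lv : rfvalue (slope xa xb xc xd xe) v (slope a b c d e).
  by rewrite /slope; do ![apply: rfvalueB => // | apply: rfvalueD => // | apply: rfvalueM => //].
split.
  by do ![apply: rfvalueD => // | apply: rfvalueM => // | apply: rfvalueV => //]; rewrite mulf_neq0.
by do ![apply: rfvalueB => // | apply: rfvalueD => // | apply: rfvalueM => // | apply: rfvalueV => //].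
Qed.

End RationalFunctions.

(** * The rational functions A and B are not zero *)

Section GenericCoefficients.
Variable R : realType.

Local Notation a := (rfvar R (inord 0)).
Local Notation b := (rfvar R (inord 1)).
Local Notation c := (rfvar R (inord 2)).
Local Notation d := (rfvar R (inord 3)).
Local Notation e := (rfvar R (inord 4)).
Local Notation f := (rfvar R (inord 5)).

Definition gen_reduction (n : nat) : ratfun6 R * ratfun6 R := reduction n a b c d e f.

Lemma rfvalue_var6 (va vb vc vd ve vf : R[i]) (v := point6 va vb vc vd ve vf) :
  (rfvalue a v va /\ rfvalue b v vb /\ rfvalue c v vc) /\
  (rfvalue d v vd /\ rfvalue e v ve /\ rfvalue f v vf).
Proof.
have h k y : (k < 6)%N -> nth 0 [:: va; vb; vc; vd; ve; vf] k = y ->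
    rfvalue (rfvar R (inord k)) v y.
  move=> k6 <-.
  have -> : nth 0 [:: va; vb; vc; vd; ve; vf] k = v (inord k).
    by rewrite /v /point6 (tnth_nth 0) inordK.
  exact: rfvalue_var.
by do !split; apply: h.
Qed.

Lemma rfvalue_gen_reduction n (va vb vc vd ve vf : R[i]) :
    (forall i, (i <= n)%N -> vf + i%:R != 0) ->
    (forall i, (i < n)%N -> excess va vb vc vd ve - i.+1%:R != 0) ->
  rfvalue (gen_reduction n).1 (point6 va vb vc vd ve vf) (reduction n va vb vc vd ve vf).1 /\
  rfvalue (gen_reduction n).2 (point6 va vb vc vd ve vf) (reduction n va vb vc vd ve vf).2.
Proof.
move=> f0 s0.
have [[ha [hb hc]] [hd [he hf]]] := rfvalue_var6 va vb vc vd ve vf.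
exact: rfvalue_reduction.
Qed.

Lemma rfshift_gen_reduction n :
  reduction n (a + 1) (b + 1) (c + 1) (d + 1) (e + 1) (f + 1)
    = (rfshift (gen_reduction n).1, rfshift (gen_reduction n).2).
Proof. by rewrite -!rfshift_var reduction_morph. Qed.

(** With a = b = c = f = 1, d = pd n and e = pe n, the hypotheses of
    reduction_gt0 hold: d + n = 0 and s = n + 1. *)
Let pd n : R[i] := - n%:R.
Let pe n : R[i] := (2 * n + 5)%:R.

Lemma excess_witness n : excess 1 1 1 (pd n) (pe n) = n.+1%:R :> R[i].
Proof. by rewrite /excess /pd /pe -natr1 natrD natrM; ring. Qed.

Lemma gen_reduction_gt0 n : exists v A B,
  [/\ rfvalue (gen_reduction n).1 v A, rfvalue (gen_reduction n).2 v B, 0 < A & 0 < B].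
Proof.
exists (point6 1 1 1 (pd n) (pe n) 1), (reduction n 1 1 1 (pd n) (pe n) 1).1,
  (reduction n 1 1 1 (pd n) (pe n) 1).2.
have f0 i : (i <= n)%N -> 1 + i%:R != 0 :> R[i] by move=> _; rewrite nat1r pnatr_eq0.
have s0 i : (i < n)%N -> excess 1 1 1 (pd n) (pe n) - i.+1%:R != 0.
  move=> hi; rewrite excess_witness subr_eq0 eqr_nat eqSS; by rewrite gtn_eqF.
have [hA hB] := rfvalue_gen_reduction f0 s0.
have [] := @reduction_gt0 R[i] n 1 1 1 (pd n) (pe n) 1; rewrite ?ltr01 ?ler0n //.
  by rewrite addNr.
by rewrite excess_witness ltr_nat.
Qed.

Lemma gen_reduction1_neq0 n : (gen_reduction n).1 != 0.
Proof.
by have [v [A [B [hA _ A0 _]]]] := gen_reduction_gt0 n; apply: rfvalue_neq0 hA; rewrite gt_eqF.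
Qed.

Lemma gen_reduction2_neq0 n : (gen_reduction n).2 != 0.
Proof.
by have [v [A [B [_ hB _ B0]]]] := gen_reduction_gt0 n; apply: rfvalue_neq0 hB; rewrite gt_eqF.
Qed.

(** A + k B is positive at the point where A and B are. *)
Lemma gen_reduction_ratio_not_nonpos_int n : ~ nonpos_int ((gen_reduction n).1 / (gen_reduction n).2).
Proof.
move=> [k E]; have [v [A [B [hA hB A0 B0]]]] := gen_reduction_gt0 n.
have {}E : (gen_reduction n).1 + k%:R * (gen_reduction n).2 = 0.
  by rewrite -[X in X + _](divfK (gen_reduction2_neq0 n)) E mulNr addNr.
have hk : rfvalue (k%:R) v k%:R.
  elim: k {E} => [|k IH]; first exact: rfvalue0.
  by rewrite -!natr1; apply: rfvalueD => //; apply: rfvalue1.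
have := rfvalue_neq0 _ (rfvalueD hA (rfvalueM hk hB)).
by rewrite E eqxx => /(_ (lt0r_neq0 (ltr_pwDl A0 (mulr_ge0 (ler0n _ _) (ltW B0))))).
Qed.

(** At the positivity point for n+1, the expression is the sum of
    slope - (s-1) >= 0 and (s-1) A'/B' > 0, where A' and B' are the values of
    A and B at the shifted point. *)
Lemma eta_den_neq0 n :
  slope a b c d e + (excess a b c d e - 1)
     * (rfshift (gen_reduction n).1 / rfshift (gen_reduction n).2 - 1) != 0.
Proof.
have [[ha [hb hc]] [hd [he hf]]] := rfvalue_var6 1 1 1 (pd n.+1) (pe n.+1) 1.
set v := point6 _ _ _ _ _ _ in ha hb hc hd he hf.
have v1 := rfvalue1 v.
have S x (x' : R[i]) : rfvalue x v x' -> rfvalue (x + 1) v (x' + 1).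
  by move=> hx; apply: rfvalueD.
have sE : excess (1 + 1) (1 + 1) (1 + 1) (pd n.+1 + 1) (pe n.+1 + 1) = n.+1%:R :> R[i].
  by rewrite excess_shift excess_witness -natr1 addrK.
have f0 i : (i <= n)%N -> 1 + 1 + i%:R != 0 :> R[i].
  by move=> _; rewrite -addrA !nat1r pnatr_eq0.
have s0 i : (i < n)%N ->
    excess (1 + 1) (1 + 1) (1 + 1) (pd n.+1 + 1) (pe n.+1 + 1) - i.+1%:R != 0 :> R[i].
  by move=> hi; rewrite sE subr_eq0 eqr_nat eqSS gtn_eqF.
have [] := rfvalue_reduction (S _ _ ha) (S _ _ hb) (S _ _ hc) (S _ _ hd) (S _ _ he) (S _ _ hf) f0 s0.
rewrite rfshift_gen_reduction /=.
have [] := @reduction_gt0 R[i] n (1 + 1) (1 + 1) (1 + 1) (pd n.+1 + 1) (pe n.+1 + 1) (1 + 1).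
- exact: addr_gt0.
- exact: addr_gt0.
- exact: addr_gt0.
- exact: addr_gt0.
- by rewrite addr_ge0.
- by rewrite /pd shiftD addNr.
- by rewrite sE ltr_nat.
set A := (reduction n _ _ _ _ _ _).1; set B := (reduction n _ _ _ _ _ _).2 => A0 B0 hA hB.
have sv : rfvalue (excess a b c d e - 1) v (excess 1 1 1 (pd n.+1) (pe n.+1) - 1).
  by rewrite /excess; do ![apply: rfvalueB => // | apply: rfvalueD => //].
have lv : rfvalue (slope a b c d e) v (slope 1 1 1 (pd n.+1) (pe n.+1)).
  by rewrite /slope; do ![apply: rfvalueB => // | apply: rfvalueD => // | apply: rfvalueM => //].
have := rfvalueD lv (rfvalueM sv (rfvalueB (rfvalue_div (lt0r_neq0 B0) hA hB) v1)).
apply: rfvalue_neq0; apply: lt0r_neq0.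
rewrite mulrBr mulr1 addrCA addrC ltr_wpDl //.
  apply: slope_ge_excess => //; rewrite /pd ?oppr_le0 ?ler0n //.
by rewrite mulr_gt0 ?divr_gt0 // excess_witness -natr1 addrK ltr0n.
Qed.

End GenericCoefficients.

(** * Perturbation of the parameter e *)

Section Continuity.
Variables (K : numFieldType) (T : Type) (F : set_system T) (FF : Filter F).
Implicit Types (u v : T -> K) (I : Type).

Lemma cvg_bigsum I (r : seq I) (g : I -> T -> K) (l : I -> K) :
  (forall i, (g i x @[x --> F] --> l i)%classic) ->
  ((\sum_(i <- r) g i x) @[x --> F] --> \sum_(i <- r) l i)%classic.
Proof.
move=> h; elim: r => [|i r IH].
  under eq_fun do rewrite big_nil; rewrite big_nil; exact: cvg_cst.
under eq_fun do rewrite big_cons; rewrite big_cons; exact: cvgD.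
Qed.

Lemma cvg_bigprod I (r : seq I) (g : I -> T -> K) (l : I -> K) :
  (forall i, (g i x @[x --> F] --> l i)%classic) ->
  ((\prod_(i <- r) g i x) @[x --> F] --> \prod_(i <- r) l i)%classic.
Proof.
move=> h; elim: r => [|i r IH].
  under eq_fun do rewrite big_nil; rewrite big_nil; exact: cvg_cst.
under eq_fun do rewrite big_cons; rewrite big_cons; exact: cvgM.
Qed.

Lemma cvg_exp u (l : K) n : (u x @[x --> F] --> l)%classic ->
  ((u x ^+ n) @[x --> F] --> l ^+ n)%classic.
Proof.
move=> h; elim: n => [|n IH]; first exact: cvg_cst.
by under eq_fun do rewrite exprS; rewrite exprS; exact: cvgM.
Qed.

Lemma cvg_rising u (l : K) n : (u x @[x --> F] --> l)%classic ->
  (rising (u x) n @[x --> F] --> rising l n)%classic.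
Proof.
move=> h; rewrite /rising; apply: cvg_bigprod => i; apply: cvgD => //; exact: cvg_cst.
Qed.

Lemma cvg_div u v (l m : K) : m != 0 ->
  (u x @[x --> F] --> l)%classic -> (v x @[x --> F] --> m)%classic ->
  (u x / v x @[x --> F] --> l / m)%classic.
Proof. by move=> m0 hu hv; apply: cvgM => //; apply: cvgV. Qed.

End Continuity.

Lemma cvg_add_dnbhs0 (K : numFieldType) (z : K) :
  (z + t @[t --> (0 : K)^'] --> z)%classic.
Proof.
rewrite -[X in (_ --> X)%classic]addr0; apply: cvgD; first exact: cvg_cst.
by apply: cvg_trans (@nbhs_dnbhs _ _).
Qed.

Lemma cvg_cst_dnbhs0 (K : numFieldType) (z : K) :
  (z @[t --> (0 : K)^'] --> z)%classic.
Proof. exact: cvg_cst. Qed.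

Lemma near_neq0_dnbhs0 (K : numFieldType) (u : K -> K) (l : K) :
  (u t @[t --> (0 : K)^'] --> l)%classic -> l != 0 ->
  (\forall t \near (0 : K)^', u t != 0)%classic.
Proof.
move=> hu l0.
have h : ((u t : K^o) @[t --> (0 : K^o)^'] --> (l : K^o))%classic by exact: hu.
by have := cvgr_neq0 l h l0 => /(_ (dnbhs_filter _)).
Qed.

(** The neighbourhoods are punctured: this is what avoids the zero of z + t
    when z = 0. *)
Lemma near_add_neq0 (K : numFieldType) (z : K) :
  (\forall t \near (0 : K)^', z + t != 0)%classic.
Proof.
have [->|z0] := eqVneq z 0.
  near=> t; rewrite add0r; near: t; exact: nbhs_dnbhs_neq.
exact: (@near_neq0_dnbhs0 K (fun t => z + t) z (@cvg_add_dnbhs0 K z) z0).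
Unshelve. all: by end_near. Qed.

Section Perturbation.
Variable R : realType.
Local Notation K := (R[i] : numFieldType).

Lemma point6_at_e (a b c d f : R[i]) (i : 'I_6) :
  (forall x, point6 a b c d x f i = x) \/
  (exists z, forall x, point6 a b c d x f i = z).
Proof.
case: i => k hk.
case: k hk => [|k] hk; first by right; exists a.
case: k hk => [|k] hk; first by right; exists b.
case: k hk => [|k] hk; first by right; exists c.
case: k hk => [|k] hk; first by right; exists d.
case: k hk => [|k] hk; first by left.
case: k hk => [|k] hk; first by right; exists f.
by [].
Qed.

Lemma meval_cvg (a b c d e f : R[i]) (p : poly6 R) :
  (mpoly.meval (point6 a b c d (e + t) f) p @[t --> (0 : K)^']
     --> (mpoly.meval (point6 a b c d e f) p : K))%classic.
Proof.
under eq_fun do rewrite mpoly.mevalE; rewrite mpoly.mevalE.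
apply: cvg_bigsum => m; apply: cvgM; first exact: cvg_cst.
apply: cvg_bigprod => i; apply: cvg_exp.
have [E|[z E]] := point6_at_e a b c d f i.
  by under eq_fun do rewrite E; rewrite E; exact: (@cvg_add_dnbhs0 K).
by under eq_fun do rewrite E; rewrite E; exact: (@cvg_cst_dnbhs0 K).
Qed.

(** The denominator of a fraction that is regular at the point stays nonzero
    along the perturbation. *)
Lemma rfvalue_near (a b c d e f y : R[i]) (x : ratfun6 R) :
    rfvalue x (point6 a b c d e f) y ->
  exists phi : R[i] -> R[i],
    (phi t @[t --> (0 : K)^'] --> (y : K))%classic /\
    (\forall t \near (0 : K)^', rfvalue x (point6 a b c d (e + t) f) (phi t))%classic.
Proof.
move=> [p [q [xE q0 ->]]].
exists (fun t => mpoly.meval (point6 a b c d (e + t) f) p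
                 / mpoly.meval (point6 a b c d (e + t) f) q); split.
  by apply: cvg_div => //; apply: meval_cvg.
have := @near_neq0_dnbhs0 K _ _ (@meval_cvg a b c d e f q) q0.
by apply: filterS => t qt; exists p, q.
Qed.

End Perturbation.

Lemma perturbed_sum_cvg (K : numFieldType) (a b c d e f : K) m N (w u : K -> K) (w0 u0 : K) :
    (w t @[t --> (0 : K)^'] --> w0)%classic -> (u t @[t --> (0 : K)^'] --> u0)%classic ->
    u0 != 0 ->
    (forall k, d + k%:R != 0) -> (forall k, e + k%:R != 0) ->
  ((\sum_(k < N) term a b c d (e + t) k
      * (rising (f + k%:R) m / rising f m - w t * ((u t + k%:R) / u t)))
     @[t --> (0 : K)^']
   --> \sum_(k < N) term a b c d e k
      * (rising (f + k%:R) m / rising f m - w0 * ((u0 + k%:R) / u0)))%classic.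
Proof.
move=> hw hu u00 d0 e0; apply: cvg_bigsum => k.
have cc (z : K) : (z @[t --> (0 : K)^'] --> z)%classic by exact: cvg_cst_dnbhs0.
apply: cvgM.
  rewrite /term; apply: cvg_div; first 2 last.
  - apply: cvgM; last exact: cc.
    apply: cvgM; first exact: cc.
    apply: cvg_rising; exact: (@cvg_add_dnbhs0 K e).
  - by rewrite !mulf_neq0 ?rising_neq0 // pnatr_eq0 -lt0n fact_gt0.
  - exact: cc.
apply: cvgB; first exact: cc.
apply: cvgM => //; apply: cvg_div => //.
by apply: cvgD => //; exact: cc.
Qed.

Lemma dnbhs0_lim_eq0 (K : numFieldType) (E : K -> K) (l : K) :
    (E t @[t --> (0 : K)^'] --> l)%classic ->
    (\forall t \near (0 : K)^', E t = 0)%classic -> l = 0.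
Proof.
move=> hl h0; apply: (cvg_unique (@norm_hausdorff _ K^o) hl).
exact: cvg_near_cst.
Qed.

Lemma limn_scaled (K : numFieldType) (S S' : nat -> K^o) (w : K) :
    cvgn S -> cvgn S' -> ((fun n => S n - w * S' n : K^o) @ \oo --> (0 : K^o))%classic ->
  limn S = w * limn S'.
Proof.
move=> hS hS' h0; apply/eqP; rewrite -subr_eq0; apply/eqP.
apply: (cvg_unique (@norm_hausdorff _ K^o) _ h0).
apply: cvgB; first exact: hS.
apply: cvgM; [exact: cvg_cst | exact: hS'].
Qed.

(** * The identity between the two series *)

Section SeriesIdentity.
Variables (R : realType) (n : nat).
Local Notation K := (R[i] : numFieldType).

Lemma rfvalue_gen_reduction_ratio (a b c d e f w u : R[i]) (v := point6 a b c d e f) :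
    rfvalue (gen_reduction R n).1 v w ->
    rfvalue ((gen_reduction R n).1 / (gen_reduction R n).2) v u -> u != 0 ->
    (forall i, (i <= n)%N -> f + i%:R != 0) ->
    (forall i, (i < n)%N -> excess a b c d e - i.+1%:R != 0) ->
  w = (reduction n a b c d e f).1 /\ w / u = (reduction n a b c d e f).2.
Proof.
move=> hw hu u0 f0 s0; have [hA hB] := rfvalue_gen_reduction f0 s0.
have wA := rfvalue_unique hw hA.
have := rfvalueM hu hB; rewrite divfK ?gen_reduction2_neq0 // => /(rfvalue_unique hA) E.
by split=> //; rewrite wA E mulrC mulKf.
Qed.

(** With the values w of A and u of A / B, the weight w (u+k)/u of the
    right-hand series is A + B k, so only the boundary term is left. *)
Lemma sum_term_residual (a b c d e f w u : R[i]) N :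
    (forall k, (k < N)%N -> d + k%:R != 0) ->
    (forall k, (k < N)%N -> e + k%:R != 0) ->
    (forall i, (i <= n)%N -> f + i%:R != 0) ->
    (forall i, (i < n)%N -> excess a b c d e - i.+1%:R != 0) ->
    rfvalue (gen_reduction R n).1 (point6 a b c d e f) w ->
    rfvalue ((gen_reduction R n).1 / (gen_reduction R n).2) (point6 a b c d e f) u ->
    u != 0 ->
  \sum_(k < N) term a b c d e k
      * (rising (f + k%:R) n.+1 / rising f n.+1 - w * ((u + k%:R) / u))
  = term a b c d e N * (N%:R * (d + N%:R - 1) * (e + N%:R - 1))
    * certificate n a b c d e f (N%:R - 1).
Proof.
move=> d0 e0 f0 s0 hw hu u0.
have [wA uB] := rfvalue_gen_reduction_ratio hw hu u0 f0 s0.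
under eq_bigr do rewrite mulrBr.
rewrite sumrB (sum_term_reduce d0 e0 f0 s0) addrAC -[RHS]add0r; congr (_ + _).
apply/eqP; rewrite subr_eq0; apply/eqP; apply: eq_bigr => k _; congr (_ * _).
by rewrite -wA -uB; field.
Qed.

Lemma seriesB_hyp4F3 (a b c d e f w u : R[i]) N :
    (forall i, f + i%:R != 0) -> (forall i, u + i%:R != 0) ->
  series (hyp4F3_term a b c (f + n.+1%:R) d e f) N
    - w * series (hyp4F3_term a b c (u + 1) d e u) N
  = \sum_(k < N) term a b c d e k
      * (rising (f + k%:R) n.+1 / rising f n.+1 - w * ((u + k%:R) / u)).
Proof.
move=> f0 u0; rewrite /series /= !big_mkord mulr_sumr -sumrB.
apply: eq_bigr => k _; rewrite (hyp4F3_termE _ _ _ _ _ _ _ f0).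
rewrite (_ : u + 1 = u + 1%:R) // (hyp4F3_termE _ _ _ _ _ _ _ u0).
rewrite [rising (u + _) 1]risingS [rising u 1]risingS /rising !big_ord0 !mul1r !addr0.
ring.
Qed.

Lemma term_eventually0 (a b c : R[i]) :
    nonpos_int a \/ nonpos_int b \/ nonpos_int c ->
  exists N, forall k d e, (N <= k)%N -> term a b c d e k = 0.
Proof.
have r0 (x : R[i]) : nonpos_int x -> exists N, forall k, (N <= k)%N -> rising x k = 0.
  move=> [j ->]; exists j.+1 => k jk; rewrite /rising (bigD1 (Ordinal jk)) //=.
  by rewrite addNr mul0r.
by move=> [/r0|[/r0|/r0]] [N hN]; exists N => k d e Nk;
  rewrite /term (hN k Nk) ?(mulr0, mul0r).
Qed.

(** For all small t <> 0 the parameters with e + t avoid the excluded values of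
    s, and the boundary term is 0 because the factor T_N is.  The sum is
    continuous at t = 0. *)
Lemma terminating_sum_eq0 (a b c d e f w u : R[i]) N :
    (forall k d e, (N <= k)%N -> term a b c d e k = 0) ->
    (forall k, d + k%:R != 0) -> (forall k, e + k%:R != 0) ->
    (forall k, f + k%:R != 0) -> u != 0 ->
    rfvalue (gen_reduction R n).1 (point6 a b c d e f) w ->
    rfvalue ((gen_reduction R n).1 / (gen_reduction R n).2) (point6 a b c d e f) u ->
  \sum_(k < N) term a b c d e k
      * (rising (f + k%:R) n.+1 / rising f n.+1 - w * ((u + k%:R) / u)) = 0.
Proof.
move=> hT d0 e0 f0 u0 /rfvalue_near[phiw [cw nw]] /rfvalue_near[phiu [cu nu]].
apply: (dnbhs0_lim_eq0 (@perturbed_sum_cvg K a b c d e f n.+1 N _ _ w u cw cu u0 d0 e0)).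
have nu0 := near_neq0_dnbhs0 cu u0.
have ne0 : (\forall t \near (0 : K)^', forall k : 'I_N, e + t + k%:R != 0)%classic.
  apply: filter_forall => k; near=> t; rewrite addrAC; near: t.
  exact: near_add_neq0.
have ns0 : (\forall t \near (0 : K)^', forall i : 'I_n,
    excess a b c d (e + t) - i.+1%:R != 0)%classic.
  apply: filter_forall => i; near=> t.
  rewrite (_ : excess a b c d (e + t) - i.+1%:R = excess a b c d e - i.+1%:R + t);
    last by rewrite /excess; ring.
  near: t; exact: near_add_neq0.
near=> t.
have /(_ _)/= h : forall k : 'I_N, e + t + k%:R != 0 by near: t.
have s0 : forall i : 'I_n, excess a b c d (e + t) - i.+1%:R != 0 by near: t.
rewrite (@sum_term_residual a b c d (e + t) f (phiw t) (phiu t)) //.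
- by rewrite hT // !mul0r.
- by move=> k hk; apply: (h (Ordinal hk)).
- by move=> i hi; apply: (s0 (Ordinal hi)).
- by near: t.
- by near: t.
- by near: t.
Unshelve. all: by end_near. Qed.

(** The difference of the partial sums tends to 0: it is eventually constant
    and equal to 0 if the series terminates, and otherwise it is the boundary
    term. *)
Lemma hyp4F3_reduction (a b c d e f w u : R[i]) :
    rfvalue (gen_reduction R n).1 (point6 a b c d e f) w ->
    rfvalue ((gen_reduction R n).1 / (gen_reduction R n).2) (point6 a b c d e f) u ->
    ~ nonpos_int d -> ~ nonpos_int e -> ~ nonpos_int f -> ~ nonpos_int u ->
    hyp4F3_cvg a b c (f + n.+1%:R) d e f -> hyp4F3_cvg a b c (u + 1) d e u ->
  hyp4F3 a b c (f + n.+1%:R) d e f = w * hyp4F3 a b c (u + 1) d e u.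
Proof.
have nz (x : R[i]) : ~ nonpos_int x -> forall i, x + i%:R != 0.
  by move=> h i; apply/eqP => /eqP; rewrite addr_eq0 => /eqP E; apply: h; exists i.
move=> hw hu /nz d0 /nz e0 /nz f0 /nz u0 cf cu.
have u00 : u != 0 by have := u0 0%N; rewrite addr0.
apply: (@limn_scaled K _ _ w cf cu).
have E N := seriesB_hyp4F3 a b c d e w N f0 u0.
rewrite (funext E) {E}.
have [ter|nonter] := pselect (nonpos_int a \/ nonpos_int b \/ nonpos_int c).
  have [N hN] := term_eventually0 ter.
  apply: cvg_near_cst; exists N => // M /= NM.
  apply: terminating_sum_eq0 => // k d' e' Mk.
  by apply: hN; apply: leq_trans Mk.
have a0 : forall i, a + i%:R != 0 by apply: nz => h; apply: nonter; left.
have b0 : forall i, b + i%:R != 0 by apply: nz => h; apply: nonter; right; left.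
have c0 : forall i, c + i%:R != 0 by apply: nz => h; apply: nonter; right; right.
pose t k : R[i]^o := term a b c d e k * (rising (f + k%:R) n.+1 / rising f n.+1).
have ct : cvgn (series t).
  have -> : t = hyp4F3_term a b c (f + n.+1%:R) d e f by apply/funext => k; rewrite hyp4F3_termE.
  exact: cf.
have s0 := excess_neq_nat d0 e0 f0 a0 b0 c0 ct.
have lim0 := boundary_cvg0 d0 e0 f0 ct.
suff -> : (fun N => \sum_(k < N) term a b c d e k
   * (rising (f + k%:R) n.+1 / rising f n.+1 - w * ((u + k%:R) / u)))
  = (fun N => term a b c d e N * (N%:R * (d + N%:R - 1) * (e + N%:R - 1))
     * certificate n a b c d e f (N%:R - 1)) by exact: lim0.
by apply/funext => N; rewrite (sum_term_residual _ _ _ _ hw hu).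
Qed.

End SeriesIdentity.

(** * The generic recursion and the theorem *)

Lemma genvar_neq0 (R : realType) (a := rfvar R (inord 0)) (b := rfvar R (inord 1))
    (c := rfvar R (inord 2)) (d := rfvar R (inord 3)) (e := rfvar R (inord 4))
    (f := rfvar R (inord 5)) :
  [/\ a * b * c != 0, excess a b c d e - 1 != 0, f != 0 & f + 1 != 0].
Proof.
(* a point with s - 1 = 1 *)
have [[ha [hb hc]] [hd [he hf]]] := rfvalue_var6 (1 : R[i]) 1 1 0 6 1.
have h1 := rfvalue1 (point6 (1 : R[i]) 1 1 0 6 1).
split.
- by apply: rfvalue_neq0 (rfvalueM (rfvalueM ha hb) hc); rewrite !mulr1 oner_neq0.
- have s1 : rfvalue (excess a b c d e - 1) (point6 (1 : R[i]) 1 1 0 6 1) (excess 1 1 1 0 6 - 1).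
    by rewrite /excess; do ![apply: rfvalueB => // | apply: rfvalueD => //].
  apply: rfvalue_neq0 s1.
  by rewrite (_ : excess 1 1 1 0 6 - 1 = 1) ?oner_neq0 // /excess; ring.
- by apply: rfvalue_neq0 hf; rewrite oner_neq0.
- by apply: rfvalue_neq0 (rfvalueD hf h1); rewrite -[1]/(1%:R) -natrD pnatr_eq0.
Qed.

Lemma slope_addr (F : fieldType) (a b c d e t : F) :
  a * b + a * c + b * c - d * e + d + e + t - 1 = slope a b c d e + t.
Proof. exact: addrAC. Qed.

Section GenericRecursion.
Variables (R : realType) (n : nat).
Local Notation a := (rfvar R (inord 0)).
Local Notation b := (rfvar R (inord 1)).
Local Notation c := (rfvar R (inord 2)).
Local Notation d := (rfvar R (inord 3)).
Local Notation e := (rfvar R (inord 4)).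
Local Notation f := (rfvar R (inord 5)).
Local Notation s := (excess a b c d e).
Local Notation nu := (rfshift (gen_reduction R n).1).
Local Notation sigma := (rfshift ((gen_reduction R n).1 / (gen_reduction R n).2)).
Local Notation eta_den := (a * b + a * c + b * c - d * e + d + e
                           + (s - 1) * (sigma - 1) - 1).

Lemma gen_reduction_rec :
  [/\ eta_den != 0,
      (gen_reduction R n.+1).1
        = (gen_reduction R n).1 + a * b * c * nu / ((s - 1) * f * sigma) &
      (gen_reduction R n.+1).1 / (gen_reduction R n.+1).2
        = (gen_reduction R n.+1).1
          * ((gen_reduction R n).1 / ((gen_reduction R n).1 / (gen_reduction R n).2)
             + a * b * c * nu / ((s - 1) * f * sigma * (a * b * c / eta_den)))^-1].
Proof.
have [abc0 s1 f0 f1] := genvar_neq0 R.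
have shA := congr1 fst (rfshift_gen_reduction R n).
have shB := congr1 snd (rfshift_gen_reduction R n).
have nu0 : rfshift (gen_reduction R n).1 != 0 by rewrite fmorph_eq0 gen_reduction1_neq0.
have B'0 : rfshift (gen_reduction R n).2 != 0 by rewrite fmorph_eq0 gen_reduction2_neq0.
have A0 := gen_reduction1_neq0 R n.
have -> : sigma = rfshift (gen_reduction R n).1 / rfshift (gen_reduction R n).2 by exact: fmorph_div.
split; first by rewrite slope_addr eta_den_neq0.
  rewrite /= in shA shB; rewrite -shA in nu0 *; rewrite -shB /gen_reduction.
  exact: (@reductionS_fst _ a b c d e f n nu0).
rewrite /= in shA shB; rewrite -shA in nu0 *; rewrite -shB in B'0 *.
rewrite /gen_reduction in A0 *; congr (_ / _).
exact: (@reductionS_snd _ a b c d e f n abc0 s1 f0 nu0 B'0 A0).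
Qed.

End GenericRecursion.

Theorem theorem1 (R : realType) :
  exists W mu : nat -> ratfun6 R,
  [/\
    (* mu m is not a constant at which the right-hand series is undefined *)
    forall m : nat, (0 < m)%N -> ~ nonpos_int (mu m),
    forall m : nat, (0 < m)%N ->
      forall a b c d e f w u : R[i],
        rfvalue (W m) (point6 a b c d e f) w ->
        rfvalue (mu m) (point6 a b c d e f) u ->
        ~ nonpos_int d -> ~ nonpos_int e -> ~ nonpos_int f ->
        ~ nonpos_int u ->
        hyp4F3_cvg a b c (f + m%:R) d e f ->
        hyp4F3_cvg a b c (u + 1) d e u ->
        hyp4F3 a b c (f + m%:R) d e f = w * hyp4F3 a b c (u + 1) d e u &
    let a := rfvar R (inord 0) in let b := rfvar R (inord 1) in
    let c := rfvar R (inord 2) in let d := rfvar R (inord 3) in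
    let e := rfvar R (inord 4) in let f := rfvar R (inord 5) in
    let s := d + e - a - b - c - 1 in
    [/\ W 2%N = 1 + a * b * c / ((s - 1) * f * (f + 1)),
        mu 2%N = (a * b * c + (s - 1) * f * (f + 1)) /
          (a * b + a * c + b * c - d * e + d + e
             + (s - 1) * (2 * f + 1) - 1) &
        forall m : nat, (2 <= m)%N ->
          let nu := rfshift (W m) in
          let sigma := rfshift (mu m) in
          let eta_den := a * b + a * c + b * c - d * e + d + e
                           + (s - 1) * (sigma - 1) - 1 in
          let eta := a * b * c / eta_den in
          [/\ eta_den != 0,
              W m.+1 = W m + a * b * c * nu / ((s - 1) * f * sigma) &
              mu m.+1 = W m.+1 *
                (W m / mu m + a * b * c * nu / ((s - 1) * f * sigma * eta))^-1]]].
Proof.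
exists (fun m => (gen_reduction R m.-1).1), (fun m => (gen_reduction R m.-1).1 / (gen_reduction R m.-1).2).
split.
- by move=> m _; apply: gen_reduction_ratio_not_nonpos_int.
- by case=> // n _ a b c d e f w u; apply: hyp4F3_reduction.
move=> a b c d e f s; have [abc0 s1 f0 f1] := genvar_neq0 R.
split; [exact: reduction1_fst | exact: reduction1_ratio | ].
case=> [hm|n _]; first by rewrite ltn0 in hm.
exact: (gen_reduction_rec R n).
Qed.
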